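(* Let $n\ge 2$ and let $G$ be the free group on the generators $u_1,\dots,u_n$. Let $|\cdot|$ denote the corresponding word-length function on $G$, and let $\gamma(s)$ be the number of negative-to-positive exponent changes, from left to right, in the reduced word $s$ in these generators. Given $0\le a\le 1$, define $\phi=\phi_a$ on $G$ by $$\phi_a(s)=a^{|s|-2\gamma(s)}\left(\frac{na^2-1}{n-1}\right)^{\gamma(s)}$$ (with $0^0=1$). Then $\phi_a$ is a pure $na$-eigenstate of $u_1+\cdots+u_n$ on $G$, the unitary representation of $G$ on Hilbert space to which $\phi_a$ gives rise is irreducible, and different values of $a\in[0,1]$ yield unitarily inequivalent representations.
   Context: Every element of $G$ is written as a reduced word with letters $u_1^{\pm1},\dots,u_n^{\pm1}$; $|s|$ is the number of letters and $\gamma(s)$ is the number of positions in which a letter $u_i^{-1}$ is immediately followed by a letter $u_j$ (e.g. $\gamma(u_1^{-2}u_2^3u_1^{-1})=1$). A state on $G$ is a positive definite function $\phi$ on $G$ with $\phi(1)=1$, extended linearly to the complex group algebra $\mathbb{C}G$ (with $s^*=s^{-1}$) and to the full group C*-algebra $C^*(G)$. It is pure if it is an extreme point of the set of states. For $x\in\mathbb{C}G$ and $\lambda\in\mathbb{C}$, a $\lambda$-eigenstate of $x$ is a state $\phi$ with $\phi((x-\lambda)^*(x-\lambda))=0$. The unitary representation to which $\phi$ gives rise is the GNS representation: the unique (up to unitary equivalence) unitary representation $\pi$ with a cyclic unit vector $\xi$ such that $\phi(s)=\langle\pi(s)\xi,\xi\rangle$ for all $s\in G$. *)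

(* Defs.v *)
From HB Require Import structures.
From mathcomp Require Import all_boot all_order all_algebra finmap.
From mathcomp Require Import complex zify.
From mathcomp Require Import boolp classical_sets reals topology normedtype.
(* Only the canonical structures of monalg are imported: its notations clash
   with those of MathComp-Analysis. *)
From mathcomp Require monalg.
Import (canonicals) monalg.

Set Implicit Arguments.
Unset Strict Implicit.
Unset Printing Implicit Defensive.

Import Order.TTheory GRing.Theory Num.Theory.
Import numFieldNormedType.Exports.

Local Open Scope classical_set_scope.
Local Open Scope ring_scope.

(* (i, true) stands for u_i and (i, false) for u_i^-1. *)
Notation letter n := ('I_n * bool)%type.

Definition linv n (x : letter n) : letter n := (x.1, ~~ x.2).

Definition reduced n (w : seq (letter n)) : bool :=
  sorted (fun x y => y != linv x) w.

Record free_group (n : nat) := FreeGroup {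
  word :> seq (letter n);
  word_reduced : reduced word
}.

HB.instance Definition _ n := [isSub for @word n].
HB.instance Definition _ n := [Choice of free_group n by <:].

(* Left multiplication of a reduced word by a letter. *)
Definition push n (x : letter n) (w : seq (letter n)) : seq (letter n) :=
  if w is y :: w' then if y == linv x then w' else x :: w else [:: x].

Definition reduce n (w : seq (letter n)) : seq (letter n) :=
  foldr (@push n) [::] w.

Section FreeGroupLaws.
Variable n : nat.
Implicit Types (x y : letter n) (u v w : seq (letter n)).

Lemma linvK : involutive (@linv n).
Proof. by case=> i b; rewrite /linv /= negbK. Qed.

Lemma reduced_push x w : reduced w -> reduced (push x w).
Proof.
case: w => [|y w] //= yw; case: ifPn => [_|yx] /=; last by rewrite yx.
exact: path_sorted yw.
Qed.

Lemma reduced_foldr w u : reduced w -> reduced (foldr (@push n) w u).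
Proof. by move=> rw; elim: u => //= x u; exact: reduced_push. Qed.

Lemma reduced_reduce w : reduced (reduce w).
Proof. exact: reduced_foldr. Qed.

Lemma push_linv x w : reduced w -> push x (push (linv x) w) = w.
Proof.
case: w => [|y w] /=; first by rewrite eqxx.
rewrite linvK; have [->|_ _] := eqVneq y x; last by rewrite /= eqxx.
by case: w => [|z w] //= /andP[/negbTE ->].
Qed.

Lemma push_linvV x w : reduced w -> push (linv x) (push x w) = w.
Proof. by move=> rw; rewrite -{2}(linvK x) push_linv. Qed.

Lemma reduce_id w : reduced w -> reduce w = w.
Proof.
elim: w => //= x w IHw xw; rewrite IHw; last exact: path_sorted xw.
by case: w xw {IHw} => [|y w] //= /andP[/negbTE ->].
Qed.

Lemma reduce_cat u v : reduce (u ++ v) = foldr (@push n) (reduce v) u.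
Proof. by rewrite /reduce foldr_cat. Qed.

Lemma foldr_push w x u : reduced w ->
  foldr (@push n) w (push x u) = push x (foldr (@push n) w u).
Proof.
move=> rw; case: u => [|y u] //=; case: eqP => [->|_] //=.
by rewrite push_linv // reduced_foldr.
Qed.

Lemma foldr_reduce w u : reduced w ->
  foldr (@push n) w (reduce u) = foldr (@push n) w u.
Proof. by move=> rw; elim: u => //= x u IHu; rewrite foldr_push // IHu. Qed.

Lemma reduced_inv w : reduced w -> reduced (rev (map (@linv n) w)).
Proof.
rewrite /reduced rev_sorted sorted_map; apply: sub_sorted => x y /=.
by rewrite linvK eq_sym.
Qed.

Definition fg_one : free_group n := @FreeGroup n [::] isT.
Definition fg_mul (a b : free_group n) : free_group n :=
  FreeGroup (reduced_reduce (word a ++ word b)).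
Definition fg_inv (a : free_group n) : free_group n :=
  FreeGroup (reduced_inv (word_reduced a)).

Lemma fg_mulA : associative fg_mul.
Proof.
move=> [a ra] [b rb] [c rc]; apply: val_inj; rewrite /fg_mul /=.
rewrite (reduce_cat a) (reduce_cat (reduce _)) foldr_reduce ?reduced_reduce //.
by rewrite foldr_cat (reduce_id (reduced_reduce _)) reduce_cat.
Qed.

Lemma fg_mul1 : left_id fg_one fg_mul.
Proof. by move=> a; apply: val_inj; rewrite /= reduce_id // word_reduced. Qed.

Lemma fg_mulr1 : right_id fg_one fg_mul.
Proof.
by move=> a; apply: val_inj; rewrite /= cats0 reduce_id // word_reduced.
Qed.

Lemma fg_mulV : left_inverse fg_one fg_inv fg_mul.
Proof.
move=> a; apply: val_inj; rewrite /= reduce_cat.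
elim: (word a) => //= x w IHw.
by rewrite rev_cons foldr_rcons push_linvV ?reduced_reduce.
Qed.

Lemma fg_invK : involutive fg_inv.
Proof.
move=> a; apply: val_inj; rewrite /= map_rev revK -map_comp.
by rewrite (eq_map (g := id)) ?map_id //; exact: linvK.
Qed.

Lemma fg_mulrV : right_inverse fg_one fg_inv fg_mul.
Proof. by move=> a; rewrite -{1}(fg_invK a) fg_mulV. Qed.

End FreeGroupLaws.

HB.instance Definition _ n := isGroup.Build (free_group n)
  (@fg_mulA n) (@fg_mul1 n) (@fg_mulr1 n) (@fg_mulV n) (@fg_mulrV n).

Definition gen n (i : 'I_n) : free_group n := @FreeGroup n [:: (i, true)] isT.

Definition wlen n (s : free_group n) : nat := size (word s).

Definition neg_to_pos n (s : free_group n) : nat :=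
  count (fun p : letter n * letter n => ~~ p.1.2 && p.2.2)
    (zip (word s) (behead (word s))).

(* Hence the truncated difference in [phi_a] below is a true difference. *)
Lemma neg_to_pos_le n (s : free_group n) : (2 * neg_to_pos s <= wlen s)%N.
Proof.
rewrite /neg_to_pos /wlen; case: (word s) => [|x w] //=.
set c := fun p : letter n * letter n => ~~ p.1.2 && p.2.2.
suff: (2 * count c (zip (x :: w) w) + x.2 <= (size w).+1)%N.
  by apply: leq_trans; rewrite leq_addr.
elim: w x => [|y w IHw] x /=; first by case: x.2.
have := IHw y; rewrite {2}/c /= mulnDr.
by case: x.2; case: y.2 => /=; lia.
Qed.

(* The vector space of finitely supported functions is the one of monalg,
   whose product only covers monoids without non-trivial units. *)
Notation group_algebra R G := (monalg.malg G R[i]).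

Section GroupAlgebra.
Variables (R : realType) (G : groupType).
Implicit Types (x y : group_algebra R G) (phi : G -> R[i]).

Definition ga_of (c : R[i]) (s : G) : group_algebra R G := monalg.mkmalgU s c.

Definition ga_mul x y : group_algebra R G :=
  \sum_(s <- monalg.msupp x) \sum_(t <- monalg.msupp y)
    ga_of (monalg.mcoeff s x * monalg.mcoeff t y) (s * t)%g.

Definition ga_star x : group_algebra R G :=
  \sum_(s <- monalg.msupp x) ga_of (Num.conj (monalg.mcoeff s x)) (s^-1)%g.

Definition lin_ext phi x : R[i] :=
  \sum_(s <- monalg.msupp x) monalg.mcoeff s x * phi s.

(* In R[i], [0 <= z] means that z is real and nonnegative. *)
Definition positive_definite phi : Prop :=
  forall (m : nat) (s : 'I_m -> G) (c : 'I_m -> R[i]),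
    0 <= \sum_(i < m) \sum_(j < m)
           Num.conj (c i) * c j * phi ((s i)^-1 * s j)%g.

Definition state phi : Prop := positive_definite phi /\ phi 1%g = 1.

Definition pure_state phi : Prop :=
  state phi /\
  forall (phi1 phi2 : G -> R[i]) (t : R), state phi1 -> state phi2 ->
    0 < t < 1 ->
    (forall s, phi s = t%:C%C * phi1 s + (1 - t)%:C%C * phi2 s) ->
    phi1 =1 phi /\ phi2 =1 phi.

Definition eigenstate (x : group_algebra R G) (lambda : R[i]) phi : Prop :=
  state phi /\
  let y := x - ga_of lambda 1%g in lin_ext phi (ga_mul (ga_star y) y) = 0.

End GroupAlgebra.

(* The inner product is linear in its first variable. *)
Record hilbert (R : realType) := Hilbert {
  hilbert_sort :> completeNormedModType R[i];
  inner : {dot hilbert_sort for (@Num.conj R[i])};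
  inner_norm : forall v : hilbert_sort, `|v| ^+ 2 = inner v v
}.

Definition unitary_op (R : realType) (H K : hilbert R) (U : H -> K) : Prop :=
  (forall v w : H, inner K (U v) (U w) = inner H v w) /\
  (forall w : K, exists v : H, U v = w).

Record unitary_rep (R : realType) (G : groupType) (H : hilbert R) :=
  UnitaryRep {
    rep_op :> G -> {linear H -> H};
    rep_unitary : forall s, unitary_op (rep_op s);
    rep1 : forall v, rep_op 1%g v = v;
    repM : forall s t v, rep_op (s * t)%g v = rep_op s (rep_op t v)
  }.

Section Representations.
Variables (R : realType) (G : groupType).

Definition orbit_span (H : hilbert R) (pi : unitary_rep G H) (xi : H) : set H :=
  [set v | exists (m : nat) (s : 'I_m -> G) (c : 'I_m -> R[i]),
     v = \sum_(i < m) c i *: pi (s i) xi].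

Definition cyclic_vector (H : hilbert R) (pi : unitary_rep G H) (xi : H) :=
  closure (orbit_span pi xi) = setT.

Definition closed_subspace (H : hilbert R) (M : set H) : Prop :=
  [/\ closed M, M 0 & forall (c : R[i]) u v, M u -> M v -> M (c *: u + v)].

Definition invariant (H : hilbert R) (pi : unitary_rep G H) (M : set H) :=
  forall s v, M v -> M (pi s v).

Definition irreducible_rep (H : hilbert R) (pi : unitary_rep G H) : Prop :=
  (exists v : H, v != 0) /\
  forall M : set H, closed_subspace M -> invariant pi M ->
    M = [set 0] \/ M = setT.

Definition unitarily_equivalent (H K : hilbert R)
    (pi : unitary_rep G H) (rho : unitary_rep G K) : Prop :=
  exists U : {linear H -> K},
    unitary_op U /\ forall s v, U (pi s v) = rho s (U v).

(* (H, pi, xi) is a GNS triple for phi, which determines it up to unitary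
   equivalence. *)
Definition is_GNS (phi : G -> R[i]) (H : hilbert R) (pi : unitary_rep G H)
    (xi : H) : Prop :=
  [/\ `|xi| = 1, cyclic_vector pi xi & forall s, phi s = inner H (pi s xi) xi].

End Representations.

Definition gen_sum (R : realType) (n : nat) : group_algebra R (free_group n) :=
  \sum_(i < n) ga_of 1 (gen i).

Definition phi_a (R : realType) (n : nat) (a : R) (s : free_group n) : R[i] :=
  (a ^+ (wlen s - 2 * neg_to_pos s) *
   ((n%:R * a ^+ 2 - 1) / (n%:R - 1)) ^+ neg_to_pos s)%:C%C.

(* Main.v *)
Require Import Defs.
From HB Require Import structures.
From mathcomp Require Import all_boot all_order all_algebra finmap.
From mathcomp Require Import complex ring lra zify.
From mathcomp Require Import boolp classical_sets functions reals topology normedtype.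
From mathcomp Require monalg.
Import (canonicals) monalg.

(** Call the translates of {1, u_1, ..., u_n} cells: they form a tree, two cells
    meeting in at most one vertex, and [phi_a (s^-1 * t)] is the product, over the
    cells crossed on the way from s to t, of the entries of one Gram matrix on the
    cell.  A product of positive semidefinite kernels is positive semidefinite.

    Everything else rests on one rigidity statement: if h satisfies
    sum_i h(u_i^-1 s) = lam h(s) for all s and is dominated by [phi_a] (as are the
    coefficients s |-> <m, pi(s) xi> in the GNS space), then h = h(1) [phi_a],
    whatever lam is.  Indeed the vectors of a cell orthogonal to its vertex nearest
    to 1 are orthogonal for different cells, so by Bessel's inequality their
    h-values form a square summable eigenfunction of u_1 + ... + u_n on a branch of
    the tree; a weighted energy of such a function cannot decrease away from the
    root, so it vanishes.  Hence the na-eigenspace in the GNS space is the line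
    through the cyclic vector, and no other eigenvalue occurs: this gives
    irreducibility, inequivalence, and, since a state in a convex decomposition of
    [phi_a] is dominated by a multiple of [phi_a], purity.

    For the GNS space itself we take all functions h dominated by the state; the
    square norm of h is the supremum of 2 Re h[y] - |y|^2 over the group algebra,
    which makes density and completeness immediate and reduces the inner product to
    the parallelogram law. *)

Set Implicit Arguments.
Unset Strict Implicit.
Unset Printing Implicit Defensive.

Import Order.TTheory GRing.Theory Num.Theory.
Local Open Scope ring_scope.

(** * Words and the tree of cells *)

Section Words.
Variable n : nat.
Implicit Types (s t g : free_group n) (x y : letter n) (u v w : seq (letter n)).

(** Cancellation happens only at the junction: once a piece [u1] survives, the next letter on its
    left keeps its neighbour from the reduced word [u], so it cannot cancel. *)
Lemma cancel_reduce u v : reduced u -> reduced v ->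
  exists u1 z v1, [/\ u = u1 ++ z, v = rev (map (@linv n) z) ++ v1
    & reduce (u ++ v) = u1 ++ v1].
Proof.
move=> ru rv; rewrite reduce_cat (reduce_id rv).
elim: u ru => [|x u IHu] /= ru; first by exists [::], [::], v.
have ru' : reduced u by exact: path_sorted ru.
have [u1 [z [v1 [eu ev ->]]]] := IHu ru'.
case: u1 eu => [|y u1] eu; last first.
  exists (x :: y :: u1), z, v1; split; rewrite ?eu //=.
  by move: ru; rewrite /reduced eu /= => /andP[/negbTE ->].
case: v1 ev => [|y v1] ev /=; first by exists [:: x], z, [::]; rewrite eu.
case: eqP => [eyx|_]; last by exists [:: x], z, (y :: v1); rewrite eu.
by exists [::], (x :: z), v1; rewrite ev eu rev_cons cat_rcons eyx.
Qed.

Definition cell (x : option 'I_n) : free_group n :=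
  if x is Some i then gen i else 1%g.

(* The vertex of the cell {1, u_1, ..., u_n} nearest to [s] in the tree of
   translates of this cell. *)
Definition gate s : option 'I_n :=
  if word s is (i, true) :: _ then Some i else None.

Lemma word_mul s t : word (s * t)%g = reduce (word s ++ word t).
Proof. by []. Qed.

Lemma word_inv s : word s^-1%g = rev (map (@linv n) (word s)).
Proof. by []. Qed.

Definition elt x : free_group n := @FreeGroup n [:: x] isT.

Lemma gen_elt i : gen i = elt (i, true).
Proof. by []. Qed.

Lemma genV_elt i : (gen i)^-1%g = elt (i, false).
Proof. exact: val_inj. Qed.

Lemma word_elt x s : word (elt x * s)%g = push x (word s).
Proof. by rewrite word_mul /= reduce_id // word_reduced. Qed.

Lemma word_eq0 s : word s = [::] -> s = 1%g.
Proof. by move=> s0; apply: val_inj. Qed.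

Lemma gate_cat s t u v : word s = u ++ v -> word t = u -> t != 1%g ->
  gate s = gate t.
Proof.
rewrite /gate => -> <-; case e: (word t) => [|y w] //=.
by rewrite (word_eq0 e) eqxx.
Qed.

(** The gate depends on the first letter only, which right multiplication by a generator destroys
    only when [g = u_i^-1] cancels to 1; then both gates are [None]. Geometrically, a cell sees
    every other cell through a single vertex. *)
Lemma gate_mul g (c : option 'I_n) : g != 1%g -> gate (g * cell c)%g = gate g.
Proof.
move=> g1; case: c => [i|] /=; last by rewrite mulg1.
have [u1 [z [v1 [eg ei e]]]] := cancel_reduce (word_reduced g) (word_reduced (gen i)).
rewrite -word_mul in e.
case/lastP: z ei eg => [|z y] /=.
  move=> ei; rewrite cats0 => eg.
  by apply: (gate_cat (u := word g) (v := v1)); rewrite // e eg.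
rewrite map_rcons rev_rcons /= => -[_ y2 ev1] eg.
case: v1 ev1 e => [|c v1]; last by move/(congr1 size); rewrite size_cat /= addnS.
case: z eg => [eg _|c z _]; last first.
  by move/(congr1 size); rewrite cats0 size_rev.
rewrite cats0 /gate => ->; rewrite eg.
by case: u1 {eg} => [|? ?]; case: y y2 => ? [].
Qed.

(** If [s^-1] is not wholly cancelled in [s^-1 * t], the product keeps its first letter; otherwise
    [t] is [s] followed by [v1], and [t^-1 * s = v1^-1] begins like [t^-1]. *)
Lemma gate_or s t : s != t -> gate s^-1%g = gate t^-1%g ->
  gate (s^-1 * t)%g = gate s^-1%g \/ gate (t^-1 * s)%g = gate s^-1%g.
Proof.
move=> st est.
have [u1 [z [v1 [es et e]]]] :=
  cancel_reduce (word_reduced s^-1%g) (word_reduced t).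
rewrite -word_mul in e.
have st1 : (s^-1 * t)%g != 1%g.
  by apply: contraNneq st => h; rewrite -(mulVKg s t) h mulg1.
case: u1 es e => [|y u1] es e; last by left; rewrite /gate e es.
right; rewrite est; apply/esym.
have -> : (t^-1 * s = (s^-1 * t)^-1)%g by rewrite invgM invgK.
apply: (gate_cat (u := rev (map (@linv n) v1)) (v := z)).
- by rewrite word_inv et map_cat rev_cat map_rev revK mapK //; exact: linvK.
- by rewrite word_inv e.
- by rewrite invg_eq1.
Qed.

End Words.

(** * The Gram matrix of a cell and the multiplicativity of [phi_a] *)

Section Cell.
Variables (R : realType) (n : nat) (a : R).
Implicit Types (s t g : free_group n) (w : seq (letter n)).

Definition cell_ip : R := (n%:R * a ^+ 2 - 1) / (n%:R - 1).

(** The values [phi_a (x^-1 * y)] on a cell: [None] is its centre 1, [Some i] its leaf [u_i]. *)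
Definition cell_gram (x y : option 'I_n) : R :=
  match x, y with
  | Some i, Some j => if i == j then 1 else cell_ip
  | None, None => 1
  | _, _ => a
  end.

Lemma cell_gramC x y : cell_gram x y = cell_gram y x.
Proof. by case: x y => [i|] [j|] //=; rewrite eq_sym. Qed.

Lemma cell_gramxx x : cell_gram x x = 1.
Proof. by case: x => [i|] //=; rewrite eqxx. Qed.

Definition phiR s : R :=
  a ^+ (wlen s - 2 * neg_to_pos s) * cell_ip ^+ neg_to_pos s.

Lemma phi_aE s : phi_a a s = (phiR s)%:C%C.
Proof. by []. Qed.

Lemma phiR1 : phiR 1%g = 1.
Proof. by rewrite /phiR /wlen /neg_to_pos /= !expr0 mulr1. Qed.

Let head_pos w := if w is (_, true) :: _ then true else false.

Lemma phiR_push s t x : word s = x :: word t -> x.2 || ~~ head_pos (word t) ->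
  phiR s = a * phiR t.
Proof.
move=> es h; have eg : neg_to_pos s = neg_to_pos t.
  rewrite /neg_to_pos es /=; case: (word t) h => [|[i []] w] //=; last by rewrite andbF.
  by rewrite orbF => ->.
have := neg_to_pos_le t; rewrite /phiR eg /wlen es /= => h'.
by rewrite subSn // exprS mulrA.
Qed.

Lemma phiR_neg_pos s t i j : word s = (j, false) :: (i, true) :: word t ->
  phiR s = cell_ip * phiR t.
Proof.
move=> es; have eg : neg_to_pos s = (neg_to_pos t).+1.
  by rewrite /neg_to_pos es /=; case: (word t).
rewrite /phiR eg /wlen es /= exprS mulrCA; congr (_ * (_ ^+ _ * _)).
by rewrite mulnS -addn2 [(2 + _)%N]addnC subnDr.
Qed.

(** The path from a vertex of the cell to [t] passes through the gate of [t]. Up to there it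
    contributes nothing, one letter without sign change (factor [a]), or a pair [u_j^-1 u_i] (factor
    [cell_ip]). *)
Lemma phiR_gate x t :
  phiR ((cell x)^-1 * t)%g = cell_gram x (gate t) * phiR ((cell (gate t))^-1 * t)%g.
Proof.
case et: (word t) => [|[i []] w].
- have gt : gate t = None by rewrite /gate et.
  rewrite gt /= invg1 mul1g; case: x => [j|] /=; last by rewrite invg1 mul1g mul1r.
  by apply: (@phiR_push _ _ (j, false)); rewrite ?et // genV_elt word_elt et.
- have gt : gate t = Some i by rewrite /gate et.
  rewrite gt /=; have : word ((gen i)^-1 * t)%g = w.
    by rewrite genV_elt word_elt et /= eqxx.
  move E: ((gen i)^-1 * t)%g => t' et'.
  case: x => [j|] /=.
    case: eqP => [->|ij]; first by rewrite E mul1r.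
    apply: (@phiR_neg_pos _ t' i j).
    by rewrite genV_elt word_elt et /= et'; case: eqP => // -[/esym/ij].
  by rewrite invg1 mul1g; by apply: (@phiR_push _ t' (i, true)); rewrite ?et ?et'.
- have gt : gate t = None by rewrite /gate et.
  rewrite gt /= invg1 mul1g; case: x => [j|] /=; last by rewrite invg1 mul1g mul1r.
  by apply: (@phiR_push _ t (j, false)); rewrite ?et // genV_elt word_elt et /= xpair_eqE andbF.
Qed.

(** Reversing a word and inverting its letters turns each negative-positive pair into another such
    pair. *)
Lemma phiRV s : phiR s^-1%g = phiR s.
Proof.
rewrite /phiR; have -> : wlen s^-1%g = wlen s by rewrite /wlen word_inv size_rev size_map.
suff -> : neg_to_pos s^-1%g = neg_to_pos s by [].
rewrite /neg_to_pos word_inv.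
elim: (word s) => [|x w IHw] //=; rewrite rev_cons.
case: w IHw => [|y w] //= <-.
rewrite rev_cons; set r := rev _.
have H (r' : seq (letter n)) (z z' : letter n) :
    count (fun p : letter n * letter n => ~~ p.1.2 && p.2.2)
      (zip (rcons (rcons r' z) z') (behead (rcons (rcons r' z) z'))) =
    (~~ z.2 && z'.2 + count (fun p : letter n * letter n => ~~ p.1.2 && p.2.2)
      (zip (rcons r' z) (behead (rcons r' z))))%N.
  elim: r' => [|c r' IHr] //=.
  case: r' IHr => [|d r'] /=; first by move=> _; rewrite !addn0 addnC.
  by move=> ->; lia.
by rewrite H /= negbK andbC.
Qed.

Lemma phiR_gater x t :
  phiR (t * cell x)%g =
  cell_gram x (gate t^-1%g) * phiR (t * cell (gate t^-1%g))%g.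
Proof.
by rewrite -phiRV invgM phiR_gate -[in RHS]phiRV invgM.
Qed.

End Cell.

(** * Positive definiteness *)

Section Steps.
Variable n : nat.
Implicit Types (s t g : free_group n).

Lemma wlenV s : wlen s^-1%g = wlen s.
Proof. by rewrite /wlen word_inv size_rev size_map. Qed.

Lemma wlenM s t : (wlen (s * t)%g <= wlen s + wlen t)%N.
Proof.
have [u1 [z [v1 [es et]]]] := cancel_reduce (word_reduced s) (word_reduced t).
rewrite -word_mul /wlen es et => ->; rewrite !size_cat.
by rewrite leq_add ?leq_addr ?leq_addl.
Qed.

Lemma gate_cell (c : option 'I_n) : gate (cell c) = c.
Proof. by case: c. Qed.

(** The induction step towards 1. If [t] ends in [u_i^-1], it is the centre of a cell with the
    shorter leaf [t u_i]. If [t] ends in [u_i], it is a leaf of the cell of [s = t u_i^-1], entered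
    at [s] or, when [s] ends in [u_j^-1], at [s u_j]. *)
Lemma cell_step t : t != 1%g -> exists s c,
  [/\ t = (s * cell c)%g, (wlen s <= wlen t)%N
    & (wlen (s * cell (gate s^-1%g))%g < wlen t)%N].
Proof.
rewrite -invg_eq1 => t1.
suff: forall r, r != 1%g -> exists s c, [/\ (r = (cell c)^-1 * s)%g,
    (wlen s <= wlen r)%N & (wlen ((cell (gate s))^-1 * s)%g < wlen r)%N].
  move=> /(_ _ t1)[s [c [e l1 l2]]]; exists s^-1%g, c; split.
  - by rewrite -[LHS]invgK e invgM invgK.
  - by rewrite wlenV -(wlenV t).
  - by rewrite invgK -wlenV invgM invgK -(wlenV t).
move=> r r1; case er: (word r) r1 => [|[i b] w]; first by rewrite (word_eq0 er) eqxx.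
move=> _; case: b er => er.
  have gr : gate r = Some i by rewrite /gate er.
  exists r, None; rewrite invg1 mul1g gr; split=> //.
  by rewrite /= genV_elt /wlen word_elt er /= eqxx.
have [s es e] : exists2 s, word s = w & r = ((gen i)^-1 * s)%g.
  exists (gen i * r)%g; last by rewrite mulKg.
  by rewrite gen_elt word_elt er /= eqxx.
exists s, (Some i); split=> //; first by rewrite /wlen er es.
case gs: (gate s) => [j|] /=; last by rewrite invg1 mul1g /wlen er es.
rewrite genV_elt /wlen word_elt er es.
by move: gs; rewrite /gate es; case: (w) => [|[k []] w'] //= [->]; rewrite eqxx /= ltnW.
Qed.

End Steps.

(** Cauchy-Schwarz against the constant 1: the squared deviations from the mean have a nonnegative
    sum. *)
Lemma sum_sqr_le (R : realFieldType) (I : finType) (P : pred I) (d : I -> R) :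
  (\sum_(i | P i) d i) ^+ 2 <= #|P|%:R * \sum_(i | P i) d i ^+ 2.
Proof.
have [/eqP/card0_eq P0|Pn0] := boolP (#|P| == 0%N).
  by rewrite !big_pred0 // ?expr0n ?mulr0.
set S := \sum_(i | P i) d i; set Q := \sum_(i | P i) _.
have m0 : 0 < #|P|%:R :> R by rewrite ltr0n lt0n.
have : 0 <= \sum_(i | P i) (d i - S / #|P|%:R) ^+ 2.
  by apply: sumr_ge0 => i _; exact: sqr_ge0.
under eq_bigr do rewrite sqrrB.
rewrite big_split sumrB /= -/Q sumr_const sumrMnl -mulr_suml -/S.
rewrite -[X in _ <= _ + X]mulr_natl -[X in _ - X]mulr_natr.
set m : R := #|P|%:R in m0 *.
have -> : Q - S * (S / m) * 2 + m * (S / m) ^+ 2 = Q - S ^+ 2 / m.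
  by field; rewrite gt_eqF.
by rewrite subr_ge0 ler_pdivrMr // mulrC.
Qed.

Section Positivity.
Variables (R : realType) (n : nat) (a : R).
Hypotheses (hn : (2 <= n)%N) (ha : 0 <= a <= 1).
Implicit Types (s t g : free_group n).

Let n1 : 1 < n%:R :> R. Proof. by rewrite ltr1n. Qed.

(** Coordinates of vectors realizing [cell_gram]: the centre is a unit vector, and a leaf is [a]
    times it plus a vertex of a regular simplex centred at 0 in the orthogonal complement, scaled so
    that leaves have norm 1. *)
Definition cell_vec (l x : option 'I_n) : R :=
  match l, x with
  | None, None => 1
  | None, Some _ => a
  | Some _, None => 0
  | Some l, Some i =>
      Num.sqrt ((1 - a ^+ 2) * n%:R / (n%:R - 1)) * ((i == l)%:R - n%:R^-1)
  end.

Lemma cell_gramE x y : cell_gram a x y = \sum_l cell_vec l x * cell_vec l y.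
Proof.
have n0 : n%:R != 0 :> R by rewrite gt_eqF // (lt_trans _ n1).
have n10 : n%:R - 1 != 0 :> R by rewrite subr_eq0 gt_eqF.
rewrite (bigD1 None) //= (reindex_omap Some id) /=; last by case.
rewrite (eq_bigl xpredT); last by move=> i /=; rewrite eqxx.
case: x y => [i|] [j|] /=; last 3 first.
- by rewrite big1 ?addr0 ?mulr1 // => l _; rewrite mulr0.
- by rewrite big1 ?addr0 ?mul1r // => l _; rewrite mul0r.
- by rewrite big1 ?addr0 ?mulr1 // => l _; rewrite mulr0.
set c : R := (1 - a ^+ 2) * n%:R / (n%:R - 1).
have c0 : 0 <= c.
  have a2 : a ^+ 2 <= 1 by case/andP: ha => a0 a1; rewrite expr_le1.
  by rewrite /c divr_ge0 ?mulr_ge0 // subr_ge0 // ltW.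
under eq_bigr do rewrite mulrACA -expr2 sqr_sqrtr //.
rewrite -mulr_sumr.
have -> : \sum_(l < n) ((i == l)%:R - n%:R^-1) * ((j == l)%:R - n%:R^-1) =
    (i == j)%:R - n%:R^-1 :> R.
  have E k : \sum_(l < n) (k == l)%:R = 1 :> R.
    by rewrite (bigD1 k) //= eqxx big1 ?addr0 // => l; rewrite eq_sym => /negbTE->.
  under eq_bigr do rewrite mulrBr.
  rewrite sumrB -mulr_suml sumrB E sumr_const card_ord -(mulr_natl n%:R^-1) divff //.
  rewrite subrr mul0r subr0 (bigD1 j) //= eqxx mulr1 big1 ?addr0 // => l.
  by rewrite eq_sym => /negbTE->; rewrite mulr0.
rewrite /cell_ip /c; case: eqP => _ /=; field; apply/andP; split=> //.
Qed.

(** Schur's product theorem: expanding one factor over [cell_vec] and absorbing its coordinates into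
    [c] leaves a sum of forms with one factor fewer. *)
Lemma gram_prod_psd (T : Type) (S : seq T) (m : nat)
    (q : T -> 'I_m -> option 'I_n) (c : 'I_m -> R) :
  0 <= \sum_(i < m) \sum_(j < m)
         c i * c j * \prod_(g <- S) cell_gram a (q g i) (q g j).
Proof.
elim: S c => [|g S IHS] c.
  under eq_bigr do under eq_bigr do rewrite big_nil mulr1.
  by under eq_bigr do rewrite -mulr_sumr; rewrite -mulr_suml -expr2 sqr_ge0.
have -> : \sum_(i < m) \sum_(j < m)
      c i * c j * \prod_(g <- g :: S) cell_gram a (q g i) (q g j) =
    \sum_l \sum_(i < m) \sum_(j < m)
      (c i * cell_vec l (q g i)) * (c j * cell_vec l (q g j)) *
      \prod_(g <- S) cell_gram a (q g i) (q g j).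
  rewrite [RHS]exchange_big; apply: eq_bigr => i _ /=.
  rewrite [RHS]exchange_big; apply: eq_bigr => j _ /=.
  rewrite big_cons cell_gramE mulr_suml mulr_sumr.
  by apply: eq_bigr => l _; ring.
by apply: sumr_ge0 => l _; exact: IHS.
Qed.

(** The factor of [g] compares the vertices of the cell of [g] nearest to 1 and to [t]. Along
    [cell_step] only the factor of [s] changes, since by [gate_mul] every other cell has one gate
    for the whole cell of [s]. *)
Lemma phiR_prod (S : seq (free_group n)) t : uniq S ->
  (forall g, (wlen g <= wlen t)%N -> g \in S) ->
  \prod_(g <- S) cell_gram a (gate g^-1%g) (gate (g^-1 * t)%g) = phiR a t.
Proof.
move=> uS; have [m] := ubnP (wlen t); elim: m t => // m IHm t.
rewrite ltnS => tm tS.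
have [->|/cell_step[s [c [et ls lt]]]] := eqVneq t 1%g.
  by rewrite phiR1 big1 // => g _; rewrite mulg1 cell_gramxx.
rewrite et phiR_gater; set r := gate s^-1%g in lt *.
rewrite -(IHm (s * cell r)%g); last 2 first.
- exact: leq_trans lt tm.
- by move=> g lg; apply: tS; exact: ltnW (leq_ltn_trans lg lt).
rewrite [LHS](bigD1_seq s) ?tS -?et //= et mulKg gate_cell -/r cell_gramC.
congr (_ * _).
rewrite [RHS](bigD1_seq s) ?tS //= mulKg gate_cell -/r cell_gramxx mul1r.
apply: eq_bigr => g gs; rewrite !mulgA !gate_mul //.
  by apply: contraNneq gs => e; rewrite -(mulVKg g s) e mulg1.
by apply: contraNneq gs => e; rewrite -(mulVKg g s) e mulg1.
Qed.

Definition word_ball (N : nat) : seq (free_group n) :=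
  undup [seq FreeGroup (reduced_reduce w) | w : N.-bseq (letter n)].

Lemma mem_word_ball N g : (wlen g <= N)%N -> g \in word_ball N.
Proof.
move=> lg; rewrite mem_undup; apply/mapP; exists (Bseq lg); first by rewrite mem_enum.
by apply: val_inj; rewrite /= reduce_id // word_reduced.
Qed.

Lemma phiR_psd (m : nat) (s : 'I_m -> free_group n) (c : 'I_m -> R) :
  0 <= \sum_(i < m) \sum_(j < m) c i * c j * phiR a ((s i)^-1 * s j)%g.
Proof.
pose L := (\sum_(i < m) wlen (s i))%N.
have sL i : (wlen (s i) <= L)%N by rewrite /L (bigD1 i) //= leq_addr.
(* [phiR_prod] is applied to [(s i)^-1 * s j], of length at most [2L], with the ball translated by
   [(s i)^-1], of length at most [L]; hence the radius [3L]. *)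
have := gram_prod_psd (word_ball (L + (L + L))) (fun g i => gate (g^-1 * s i)%g) c.
congr (0 <= _); apply: eq_bigr => i _; apply: eq_bigr => j _; congr (_ * _).
set S := [seq ((s i)^-1 * g)%g | g <- word_ball (L + (L + L))].
rewrite -(@phiR_prod S); first by rewrite big_map; apply: eq_bigr => g _;
  rewrite invgM invgK mulgA mulgK.
- by rewrite map_inj_uniq ?undup_uniq //; exact: mulgI.
- move=> g lg; apply/mapP; exists (s i * g)%g; last by rewrite mulKg.
  apply: mem_word_ball; apply: leq_trans (wlenM _ _) _; rewrite leq_add //.
  by apply: leq_trans lg _; apply: leq_trans (wlenM _ _) _; rewrite wlenV leq_add.
Qed.

End Positivity.

(** * Square summable eigenfunctions *)

Section Descendants.
Variable n : nat.
Implicit Types (s t g : free_group n).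

Definition extends (x : letter n) s : bool :=
  if word s is y :: _ then y != linv x else true.

Lemma word_extends x s : extends x s -> word (elt x * s)%g = x :: word s.
Proof. by rewrite word_elt /extends; case: (word s) => //= y w /negbTE ->. Qed.

(** The branch of words ending in [s], to depth [m]. Words grow on the left, the side on which the
    eigenvalue equation acts. *)
Fixpoint descendants (m : nat) s : seq (free_group n) :=
  s :: if m is m'.+1 then
    [seq t | x <- [seq x <- enum {: letter n} | extends x s],
             t <- descendants m' (elt x * s)%g]
  else [::].

Lemma descendants_suffix m s t : t \in descendants m s ->
  exists u, word t = u ++ word s.
Proof.
elim: m s t => [|m IHm] s t /=; first by rewrite inE => /eqP ->; exists [::].
rewrite inE => /predU1P[->|]; first by exists [::].
case/allpairsPdep => x [t'] [+ + ->]; rewrite mem_filter => /andP[ok _].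
by move=> /IHm[u ->]; exists (rcons u x); rewrite word_extends // cat_rcons.
Qed.

Lemma descendants_uniq m s : uniq (descendants m s).
Proof.
elim: m s => [|m IHm] s //=; apply/andP; split.
  apply/negP => /allpairsPdep[x [t]] [+ + st]; rewrite mem_filter => /andP[ok _].
  move=> /descendants_suffix[u]; rewrite -st word_extends //.
  by move/(congr1 size); rewrite size_cat /=; lia.
apply: allpairs_uniq_dep => [||p q].
- by rewrite filter_uniq // enum_uniq.
- by move=> x _; exact: IHm.
case/allpairsPdep => x [t] [+ + ->]; rewrite mem_filter => /andP[ok _].
move=> /descendants_suffix[u tu].
case/allpairsPdep => x' [t'] [+ + ->]; rewrite mem_filter => /andP[ok' _] /=.
move=> /descendants_suffix[u' tu'] tt'; rewrite -tt' in tu' *.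
rewrite word_extends // in tu; rewrite word_extends // in tu'.
suff -> : x = x' by [].
(* The letter just before the common suffix [word s] identifies the child. *)
move: tu'; rewrite tu -!cat_rcons => e; have sz : size u = size u'.
  by move/(congr1 size): e; rewrite !size_cat !size_rcons; lia.
by move/eqP: e; rewrite eqseq_cat ?size_rcons ?sz // => /andP[/eqP/rcons_inj[]].
Qed.

End Descendants.

(** * Growth of the energy along a branch *)

Section Energy.
Variables (R : realType) (n : nat) (lam : R) (f : free_group n -> R).
Hypothesis hn : (2 <= n)%N.
Hypothesis feq : forall s, s != 1%g ->
  \sum_(i < n) f ((gen i)^-1 * s)%g = lam * f s.
Implicit Types (s t g : free_group n).

Let n1 : 1 < n%:R :> R. Proof. by rewrite ltr1n. Qed.

(* With these weights [leaf_bound] and Cauchy-Schwarz on the leaves of a cell bound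
   the energy of a vertex by that of its neighbours further out. *)
Let al : R := n%:R - 1.
Let be : R := Num.max (n%:R - lam ^+ 2) 0.
Let al0 : 0 < al. Proof. by rewrite subr_gt0. Qed.
Let be0 : 0 <= be. Proof. by rewrite le_max lexx orbT. Qed.

Let weight s : R := if gate s is Some _ then be else al.

Fixpoint energy (m : nat) s : R :=
  weight s * f s ^+ 2 +
  if m is m'.+1 then \sum_(x | extends x s) energy m' (elt x * s)%g else 0.

Lemma energyE m s : energy m s = \sum_(t <- descendants m s) weight t * f t ^+ 2.
Proof.
elim: m s => [|m IHm] s /=; first by rewrite big_seq1 addr0.
rewrite big_cons big_allpairs_dep big_filter big_enum_cond; congr (_ + _).
by apply: eq_bigr => x _; exact: IHm.
Qed.

Let weight_ge0 s : 0 <= weight s.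
Proof. by rewrite /weight; case: (gate s) => [_|]; rewrite ?be0 // ltW. Qed.

Lemma energy_ge0 m s : 0 <= energy m s.
Proof. by rewrite energyE sumr_ge0 // => t _; rewrite mulr_ge0 ?sqr_ge0. Qed.

(* [v] and [d_i] are the values on the leaves of a cell with central value [c]. *)
Let leaf_bound (j : 'I_n) (v c : R) (d : 'I_n -> R) :
  v + \sum_(i | i != j) d i = lam * c ->
  be / n%:R * v ^+ 2 <= be * c ^+ 2 + al * \sum_(i | i != j) d i ^+ 2.
Proof.
have cj : #|[pred i : 'I_n | i != j]| = n.-1 by have := cardC1 j; rewrite card_ord.
have := sum_sqr_le [pred i | i != j] d; rewrite cj.
have -> : n.-1%:R = al :> R by rewrite /al -subn1 natrB // ltnW.
set D := \sum_(i | i != j) d i; set Q := \sum_(i | i != j) _ => DQ e.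
have {e} -> : v = lam * c - D by rewrite -e addrK.
apply: (@le_trans _ _ (be * c ^+ 2 + D ^+ 2)); last by rewrite lerD2l.
have n0 : 0 < n%:R :> R by exact: lt_trans n1.
rewrite mulrAC ler_pdivrMr //.
rewrite /be; case: (leP (n%:R - lam ^+ 2) 0) => [_|].
  by rewrite !mul0r add0r mulr_ge0 ?sqr_ge0 // ltW.
set b := n%:R - lam ^+ 2 => b0; have -> : n%:R = b + lam ^+ 2 by rewrite /b; ring.
rewrite -subr_ge0; have -> : (b * c ^+ 2 + D ^+ 2) * (b + lam ^+ 2) -
    b * (lam * c - D) ^+ 2 = (b * c + lam * D) ^+ 2 by ring.
exact: sqr_ge0.
Qed.

Let neg_energy k s := forall m, (2 * k <= m.+1)%N ->
  k%:R * (al * f s ^+ 2) <= energy m s.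

(** The bracket is the right side of [leaf_bound] for the cell centred at [s], whose leaf [u_j^-1 s]
    is the parent of [s]. *)
Let pos_energy k s j := forall m, (2 * k <= m)%N ->
  k%:R * (be * f s ^+ 2 + al * \sum_(i | i != j) f ((gen i)^-1 * s)%g ^+ 2)
  <= energy m s.


Let neg_start s := s != 1%g /\ gate s = None.

Let neg_start_genV i s : extends (i, false) s -> neg_start ((gen i)^-1 * s)%g.
Proof.
rewrite genV_elt => /word_extends es; rewrite /neg_start /gate es; split=> //.
by apply: contra_eq_neq es => ->.
Qed.

Let gate_gen i s : extends (i, true) s -> gate (gen i * s)%g = Some i.
Proof. by rewrite gen_elt => /word_extends es; rewrite /gate es. Qed.

Let extends_neg s i : neg_start s -> extends (i, false) s.
Proof.
by case=> _; rewrite /extends /gate; case: (word s) => [|[j []] w] //= _; rewrite xpair_eqE andbF.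
Qed.

Let extends_pos s j i : gate s = Some j -> extends (i, false) s = (i != j).
Proof.
rewrite /extends /gate; case: (word s) => [|[k []] w] //= [->].
by rewrite xpair_eqE andbT eq_sym.
Qed.

Let extends_pos_pos s j i : gate s = Some j -> extends (i, true) s.
Proof.
rewrite /extends /gate; case: (word s) => [|[k []] w] //= _.
by rewrite xpair_eqE andbF.
Qed.

Let sum_letters (F : letter n -> R) (P : pred (letter n)) :
  \sum_(x | P x) F x = \sum_(i | P (i, true)) F (i, true) +
                       \sum_(i | P (i, false)) F (i, false).
Proof.
rewrite [LHS]big_mkcond [X in _ = X + _]big_mkcond [X in _ = _ + X]big_mkcond.
rewrite -big_split /=.
transitivity (\sum_i \sum_(b : bool) if P (i, b) then F (i, b) else 0).
  by rewrite pair_bigA; apply: eq_bigr; case.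
by apply: eq_bigr => i _; rewrite big_bool.
Qed.

(** The child [u_i s] is the centre of a cell whose leaf nearest the root is [s], so [leaf_bound]
    applies with [v = f s]. *)
Let child_bound k m i s : (forall s j, gate s = Some j -> pos_energy k s j) ->
  (2 * k <= m)%N -> extends (i, true) s ->
  k%:R * (be / n%:R * f s ^+ 2) <= energy m (gen i * s)%g.
Proof.
move=> IHk km ok; apply: le_trans (IHk _ i (gate_gen ok) m km).
rewrite ler_wpM2l //; apply: leaf_bound.
rewrite -feq; first by rewrite [RHS](bigD1 i) //= mulKg.
by apply: contra_eq_neq (gate_gen ok) => ->.
Qed.

(** The energy of a vertex is its own term plus the energies of its children. For a negative first
    letter, the bounds of order [k] on the children add up to [k] copies of the vertex's term
    ([E3]), and the vertex supplies one more. For a positive one, the negative children already obey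
    the bound of order [k+1]. *)
Lemma energy_growth k :
  (forall s, neg_start s -> neg_energy k s) /\
  (forall s j, gate s = Some j -> pos_energy k s j).
Proof.
have n0 : 0 < n%:R :> R by exact: lt_trans n1.
elim: k => [|k [IHn IHp]].
  by split=> s => [_|j _] m _; rewrite mul0r energy_ge0.
have negk s : neg_start s -> neg_energy k.+1 s.
  move=> ns [|m] km; first by lia.
  rewrite /= {1}/weight; case: (ns) => s1 gs; rewrite gs sum_letters.
  have alf : lam ^+ 2 * f s ^+ 2 <= n%:R * \sum_(i < n) f ((gen i)^-1 * s)%g ^+ 2.
    have := sum_sqr_le xpredT (fun i : 'I_n => f ((gen i)^-1 * s)%g).
    by rewrite feq // exprMn card_ord.
  (* The first letter of [s] is some [u_j^-1], so the other [n - 1 = al] positive letters extend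
     [s]. *)
  have [j okj] : exists j, forall i, i != j -> extends (i, true) s.
    move: gs s1; rewrite /extends /gate; case: (word s) (@word_eq0 _ s) => [->|[j []] w] //.
    by move=> _ _ _; exists j => i; rewrite xpair_eqE andbT eq_sym.
  have E1 : k%:R * (al * (be / n%:R * f s ^+ 2)) <=
      \sum_(i | extends (i, true) s) energy m (elt (i, true) * s)%g.
    apply: (@le_trans _ _ (\sum_(i | i != j) energy m (elt (i, true) * s)%g)).
      rewrite mulrCA (@le_trans _ _ (\sum_(i < n | i != j) k%:R * (be / n%:R * f s ^+ 2))) //.
        rewrite sumr_const cardC1 card_ord -[leRHS]mulr_natl.
        by rewrite -subn1 natrB ?(ltnW hn).
      by apply: ler_sum => i /okj ok; apply: child_bound; [exact: IHp|lia|].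
    rewrite [leLHS]big_mkcond [leRHS]big_mkcond; apply: ler_sum => i _.
    case: ifP => [/okj ->|_] //; case: ifP => // _; exact: energy_ge0.
  have E2 : k%:R * (al * \sum_(i < n) f ((gen i)^-1 * s)%g ^+ 2) <=
      \sum_(i | extends (i, false) s) energy m (elt (i, false) * s)%g.
    rewrite [leRHS](eq_bigl xpredT); last by move=> i; rewrite extends_neg.
    rewrite !mulr_sumr; apply: ler_sum => i _; rewrite -genV_elt.
    by apply: IHn; [apply: neg_start_genV; exact: extends_neg|lia].
  have E3 : al * f s ^+ 2 <= al * (be / n%:R * f s ^+ 2) +
      al * \sum_(i < n) f ((gen i)^-1 * s)%g ^+ 2.
    rewrite -mulrDr ler_pM2l //; rewrite -ler_pdivrMl // in alf.
    apply: le_trans (lerD (lexx _) alf); rewrite -subr_ge0.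
    have -> : be / n%:R * f s ^+ 2 + n%:R^-1 * (lam ^+ 2 * f s ^+ 2) - f s ^+ 2 =
      (be - (n%:R - lam ^+ 2)) / n%:R * f s ^+ 2 by field; rewrite gt_eqF.
    rewrite mulr_ge0 ?sqr_ge0 // divr_ge0 ?(ltW n0) // subr_ge0.
    by rewrite /be le_max lexx.
  have := ler_wpM2l (ler0n R k) E3; rewrite mulrDr -[k.+1%:R]natr1; lra.
split=> // s j gs [|m] km; first by lia.
rewrite /= {1}/weight gs sum_letters.
have E1 : k%:R * (be * f s ^+ 2) <=
    \sum_(i | extends (i, true) s) energy m (elt (i, true) * s)%g.
  rewrite (eq_bigl xpredT); last by move=> i; rewrite (extends_pos_pos _ gs).
  rewrite (@le_trans _ _ (\sum_(i < n) k%:R * (be / n%:R * f s ^+ 2))) //.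
    rewrite sumr_const card_ord -[leRHS]mulr_natl le_eqVlt; apply/orP; left.
    by apply/eqP; field; rewrite gt_eqF.
  apply: ler_sum => i _; apply: child_bound; [exact: IHp|lia|].
  exact: extends_pos_pos gs.
have E2 : k.+1%:R * (al * \sum_(i | i != j) f ((gen i)^-1 * s)%g ^+ 2) <=
    \sum_(i | extends (i, false) s) energy m (elt (i, false) * s)%g.
  rewrite [leRHS](eq_bigl (fun i => i != j)); last by move=> i; exact: extends_pos.
  rewrite !mulr_sumr; apply: ler_sum => i ij; rewrite -genV_elt.
  apply: negk; last by lia.
  by apply: neg_start_genV; rewrite (extends_pos _ gs).
rewrite -[k.+1%:R]natr1 in E2 *; lra.
Qed.

(** Square summability bounds the energy at [u_i^-1] independently of the depth, against its linear
    growth. The vertex 1, where the equation is not assumed, lies outside this branch. *)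
Lemma square_summable_genV (C : R) :
  (forall S : seq (free_group n), uniq S -> \sum_(t <- S) f t ^+ 2 <= C) ->
  forall i, f (gen i)^-1%g = 0.
Proof.
move=> fC i; apply/eqP; rewrite -sqrf_eq0.
set x := f _ ^+ 2; have x0 : 0 <= x by exact: sqr_ge0.
have ns : neg_start (gen i)^-1%g by rewrite genV_elt.
have H (k : nat) : k%:R * (al * x) <= (al + be) * C.
  apply: le_trans ((energy_growth k).1 _ ns (2 * k)%N (leqnSn _)) _.
  rewrite energyE; apply: le_trans (ler_wpM2l _ (fC _ (descendants_uniq _ _))).
    rewrite mulr_sumr; apply: ler_sum => t _; rewrite ler_wpM2r ?sqr_ge0 //.
    by rewrite /weight; case: (gate t) => [_|]; rewrite (lerDr, lerDl) ?be0 ?(ltW al0).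
  by rewrite addr_ge0 // ltW.
rewrite eq_le x0 andbT leNgt; apply/negP => xp.
have axp : 0 < al * x by exact: mulr_gt0.
have := H (Num.truncn ((al + be) * C / (al * x))).+1.
rewrite -ler_pdivlMr // leNgt => /negP; apply.
have C0 : 0 <= C by have := fC [::] isT; rewrite big_nil.
have y0 : 0 <= (al + be) * C / (al * x).
  apply: divr_ge0 (ltW axp); apply: mulr_ge0 C0; apply: addr_ge0 be0; exact: ltW.
by have /andP[] := truncn_itv y0.
Qed.

End Energy.

(** * Dominated eigenfunctions *)

(** Because [1 + (n-1) cell_ip = n a^2], the leaf vectors sum to [na] times the central one; this is
    the source of the eigenvalue. *)
Lemma cell_gram_sum (R : realType) n (a : R) (c : option 'I_n) : (2 <= n)%N ->
  \sum_(i < n) cell_gram a c (Some i) = n%:R * a * cell_gram a c None.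
Proof.
move=> hn; have n1 : n%:R - 1 != 0 :> R by rewrite subr_eq0 pnatr_eq1; lia.
case: c => [j|] /=; last by rewrite sumr_const card_ord mulr1 mulr_natl.
rewrite (bigD1 j) //= eqxx (eq_bigr (fun=> cell_ip n a)) => [|i]; last first.
  by rewrite eq_sym => /negbTE ->.
rewrite sumr_const cardC1 card_ord -[_ *+ _]mulr_natl -subn1 natrB ?(ltnW hn) //.
by rewrite /cell_ip; field.
Qed.

Section Eigenfunctions.
Variables (R : realType) (n : nat) (lam : R).
Hypothesis hn : (2 <= n)%N.
Implicit Types (s t g : free_group n).

(** Right translation preserves the equation and the square sums, so any [t] can be moved to
    [u_i^-1]. *)
Lemma square_summable_eigenfunction0 (f : free_group n -> R) (C : R) :
  (forall s, \sum_(i < n) f ((gen i)^-1 * s)%g = lam * f s) ->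
  (forall S : seq (free_group n), uniq S -> \sum_(t <- S) f t ^+ 2 <= C) ->
  forall t, f t = 0.
Proof.
move=> feq fC t; pose i : 'I_n := Ordinal (ltnW hn).
rewrite -(mulKg (gen i) t).
apply: (@square_summable_genV _ _ lam (fun s => f (s * (gen i * t))%g) _ _ C) => //.
  by move=> s _; rewrite -feq; apply: eq_bigr => j _; rewrite !mulgA.
move=> S uS; rewrite -(big_map (fun s => s * (gen i * t))%g xpredT (fun s => f s ^+ 2)).
by apply: fC; rewrite map_inj_uniq //; exact: mulIg.
Qed.

Variables (a : R) (h : free_group n -> R) (C : R).
Hypothesis hdom : forall y : seq (R * free_group n),
  (\sum_(p <- y) p.1 * h p.2) ^+ 2 <=
  C * \sum_(p <- y) \sum_(q <- y) p.1 * q.1 * phiR a (p.2^-1 * q.2)%g.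
Hypothesis heq : forall s, \sum_(i < n) h ((gen i)^-1 * s)%g = lam * h s.

Section CellDefect.
Variables (c r : option 'I_n).

Let k := cell_gram a c r.

(** The value of [h] on the component of the vertex [s c] orthogonal to [s r]; below, [s r] is the
    vertex of the cell nearest to 1. *)
Definition cell_defect s := h (s * cell c)%g - k * h (s * cell r)%g.

Lemma cell_defect_eq s :
  \sum_(i < n) cell_defect ((gen i)^-1 * s)%g = lam * cell_defect s.
Proof.
rewrite sumrB -mulr_sumr /cell_defect mulrBr mulrCA -!heq.
by congr (_ - _ * _); apply: eq_bigr => i _; rewrite mulgA.
Qed.

(** The inner product of the defect vectors of the cells of 1 and [g]. *)
Let M g := phiR a ((cell c)^-1 * (g * cell c))%g -
  k * phiR a ((cell c)^-1 * (g * cell r))%g -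
  k * phiR a ((cell r)^-1 * (g * cell c))%g +
  k ^+ 2 * phiR a ((cell r)^-1 * (g * cell r))%g.

Let MV g : M g^-1%g = M g.
Proof.
have E x y : phiR a ((cell x)^-1 * (g^-1 * cell y))%g =
    phiR a ((cell y)^-1 * (g * cell x))%g.
  by rewrite -phiRV !invgM !invgK mulgA.
by rewrite /M !E; ring.
Qed.

(** The whole cell of [g] lies behind [r], so its vectors do not distinguish [c] from [k] times
    [r]. *)
Let M_gate g : g != 1%g -> gate g = r -> M g = 0.
Proof.
move=> g1 gr.
have E x : phiR a ((cell c)^-1 * (g * cell x))%g =
    k * phiR a ((cell r)^-1 * (g * cell x))%g.
  by rewrite phiR_gate gate_mul // gr.
by rewrite /M !E; ring.
Qed.

Let M1 : M 1%g = 1 - k ^+ 2.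
Proof.
have E x y : phiR a ((cell x)^-1 * (1 * cell y))%g = cell_gram a x y.
  by rewrite mul1g phiR_gate gate_cell mulVg phiR1 mulr1.
by rewrite /M !E !cell_gramxx [cell_gram a r c]cell_gramC -/k; ring.
Qed.

(** Bessel's inequality: by [gate_or] and [M_gate], the defect vectors of cells entered at [r] are
    pairwise orthogonal, of square norm [1 - k^2]. *)
Lemma cell_defect_square_summable (S : seq (free_group n)) : uniq S ->
  \sum_(t <- S) (if gate t^-1%g == r then cell_defect t else 0) ^+ 2 <=
  `|C * (1 - k ^+ 2)|.
Proof.
move=> uS; rewrite (eq_bigr (fun t =>
  if gate t^-1%g == r then cell_defect t ^+ 2 else 0)); last first.
  by move=> t _; case: ifP; rewrite ?expr0n.
rewrite -big_mkcond -big_filter; set S' := [seq _ <- _ | _].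
have uS' : uniq S' by exact: filter_uniq.
pose D := cell_defect; set T := \sum_(t <- S') _.
(* The defect vectors weighted by the values of [h] on them; [hdom] then reads
   [T^2 <= C (1 - k^2) T]. *)
pose y := [seq (D t, (t * cell c)%g) | t <- S'] ++
          [seq (- k * D t, (t * cell r)%g) | t <- S'].
have yh : \sum_(p <- y) p.1 * h p.2 = T.
  rewrite big_cat !big_map /= -big_split /=; apply: eq_bigr => t _.
  by rewrite /D /cell_defect; ring.
have yy : \sum_(p <- y) \sum_(q <- y) p.1 * q.1 * phiR a (p.2^-1 * q.2)%g =
    (1 - k ^+ 2) * T.
  transitivity (\sum_(t <- S') \sum_(t' <- S') D t * D t' * M (t^-1 * t')%g).
    rewrite big_cat !big_map /= -big_split /=; apply: eq_bigr => t _.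
    rewrite !big_cat !big_map /= -!big_split /=; apply: eq_bigr => t' _.
    by rewrite /M !invgM -!mulgA; ring.
  rewrite mulr_sumr; apply: eq_big_seq => t tS'.
  rewrite (bigD1_seq t) //= mulVg M1 big1_seq ?addr0 => [|t' /andP[t't t'S']].
    by rewrite mulrC.
  suff -> : M (t^-1 * t')%g = 0 by rewrite mulr0.
  move: tS' t'S'; rewrite !mem_filter => /andP[/eqP gt _] /andP[/eqP gt' _].
  have st g g' : g != g' -> (g^-1 * g')%g != 1%g.
    by apply: contraNneq => e; rewrite -(mulVKg g g') e mulg1.
  have tt' : t != t' by rewrite eq_sym.
  have [] := gate_or tt'; rewrite ?gt ?gt' // => e.
    by apply: M_gate => //; exact: st.
  by rewrite -MV invgM invgK; apply: M_gate => //; exact: st.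
have := hdom y; rewrite yh yy => H.
have T0 : 0 <= T by apply: sumr_ge0 => t _; exact: sqr_ge0.
have [T0'|Tp] := eqVneq T 0; first by rewrite -/T T0'.
apply: le_trans (ler_norm _); rewrite -/T -(@ler_pM2r _ T).
  by rewrite -expr2 (le_trans H) // mulrA.
by rewrite lt_def Tp.
Qed.

(** Cut off to [gate s^-1 = r], the defect solves the equation off 1, as left multiplication of
    [s <> 1] by [u_i^-1] preserves this gate. At 1 the left side vanishes by [square_summable_genV]
    and the right side by hypothesis. *)
Lemma cell_defect_gate0 : (r = None -> lam * cell_defect 1%g = 0) ->
  forall s, gate s^-1%g = r -> cell_defect s = 0.
Proof.
move=> h1; pose f s := if gate s^-1%g == r then cell_defect s else 0.
have fsum := cell_defect_square_summable.
have gateV i s : s != 1%g -> gate ((gen i)^-1 * s)^-1%g = gate s^-1%g.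
  move=> s1; rewrite invgM invgK; apply: (gate_mul (Some i)).
  by rewrite invg_eq1.
have feq1 s : s != 1%g -> \sum_(i < n) f ((gen i)^-1 * s)%g = lam * f s.
  move=> s1; rewrite /f; under eq_bigr do rewrite gateV //.
  case: eqP => _; first exact: cell_defect_eq.
  by rewrite big1 // mulr0.
have fV := square_summable_genV hn feq1 fsum.
have feq s : \sum_(i < n) f ((gen i)^-1 * s)%g = lam * f s.
  have [->|] := eqVneq s 1%g; last exact: feq1.
  under eq_bigr do rewrite mulg1.
  rewrite big1 // /f invg1; case: eqP => [e|_]; last by rewrite mulr0.
  by rewrite h1 // -e.
move=> s gs; have := square_summable_eigenfunction0 feq fsum s.
by rewrite /f gs eqxx.
Qed.

End CellDefect.

Lemma cell_defect0 c s : cell_defect c (gate s^-1%g) s = 0.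
Proof.
have some j t d : gate t^-1%g = Some j -> cell_defect d (Some j) t = 0.
  by apply: cell_defect_gate0.
case e: (gate s^-1%g) => [j|]; first exact: some.
apply: cell_defect_gate0 e => _.
(* The cell of [u_i^-1] is entered at its leaf 1, so the case already settled gives its values;
   summed over [i], they cancel by [cell_gram_sum]. *)
have h1 i d : h ((gen i)^-1 * cell d)%g = cell_gram a d (Some i) * h 1%g.
  apply/eqP; rewrite -subr_eq0 -(mulVg (gen i)); apply/eqP.
  by apply: (some i (gen i)^-1%g d); rewrite invgK.
have h1' i : h (gen i)^-1%g = a * h 1%g by rewrite -(h1 i None) mulg1.
rewrite -cell_defect_eq /cell_defect.
under eq_bigr do rewrite !mulg1 h1 h1' mulrA -mulrBl.
rewrite -mulr_suml sumrB cell_gram_sum // sumr_const card_ord; ring.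
Qed.

(** By [cell_defect0] and [phiR_gater], both sides obey the same recursion through the entry
    vertices of cells. *)
Lemma dominated_eigenfunction s : h s = h 1%g * phiR a s.
Proof.
have [m] := ubnP (wlen s); elim: m s => // m IHm s sm.
have [->|/cell_step[t [c [es _ lt]]]] := eqVneq s 1%g; first by rewrite phiR1 mulr1.
have /eqP := cell_defect0 c t; rewrite subr_eq0 -es => /eqP ->.
by rewrite es phiR_gater IHm 1?mulrCA // (leq_trans lt).
Qed.

End Eigenfunctions.

(** * Inner products from the parallelogram law *)

Section ComplexParts.
Variable R : realType.
Implicit Types (z w : R[i]) (x : R).
Import complex.

Lemma ReD z w : Re (z + w) = Re z + Re w. Proof. by case: z w => [? ?] []. Qed.
Lemma ImD z w : Im (z + w) = Im z + Im w. Proof. by case: z w => [? ?] []. Qed.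
Lemma ReN z : Re (- z) = - Re z. Proof. by case: z. Qed.
Lemma ImN z : Im (- z) = - Im z. Proof. by case: z. Qed.
Lemma Re_realM x z : Re (x%:C%C * z) = x * Re z.
Proof. by case: z => a b /=; rewrite mul0r subr0. Qed.
Lemma Im_realM x z : Im (x%:C%C * z) = x * Im z.
Proof. by case: z => a b /=; rewrite mul0r addr0. Qed.
Lemma ReJ z : Re z^* = Re z. Proof. by case: z. Qed.
Lemma ImJ z : Im z^* = - Im z. Proof. by case: z. Qed.
Lemma Re_sum I (r : seq I) (P : pred I) (F : I -> R[i]) :
  Re (\sum_(i <- r | P i) F i) = \sum_(i <- r | P i) Re (F i).
Proof. by elim/big_rec2: _ => // i x z _ <-; rewrite ReD. Qed.
Lemma Im_sum I (r : seq I) (P : pred I) (F : I -> R[i]) :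
  Im (\sum_(i <- r | P i) F i) = \sum_(i <- r | P i) Im (F i).
Proof. by elim/big_rec2: _ => // i x z _ <-; rewrite ImD. Qed.
Lemma complex_eq z w : Re z = Re w -> Im z = Im w -> z = w.
Proof. by case: z w => [? ?] [? ?] /= -> ->. Qed.
Lemma sqr_norm_complex z : `|z| ^+ 2 = (Re z ^+ 2 + Im z ^+ 2)%:C%C.
Proof. by rewrite -add_Re2_Im2. Qed.

End ComplexParts.

(** Vanishing on the integers, [f] has period 1 and is bounded everywhere; then [f (k x) = k f x]
    forces [f x = 0]. *)
Lemma additive_bounded_eq0 (R : realType) (f : R -> R) (M : R) :
  {morph f : x y / x + y} -> f 1 = 0 ->
  (forall x, 0 <= x <= 1 -> `|f x| <= M) -> forall x, f x = 0.
Proof.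
move=> fD f1 fM.
have f0 : f 0 = 0 by apply: (@addrI _ (f 0)); rewrite -fD !addr0.
have fN x : f (- x) = - f x by apply: (@addrI _ (f x)); rewrite -fD !subrr f0.
have fMn x (k : nat) : f (k%:R * x) = k%:R * f x.
  elim: k => [|k IHk]; first by rewrite !mul0r.
  by rewrite -!natr1 !mulrDl !mul1r fD IHk.
have fi (m : int) : f m%:~R = 0.
  have fn (k : nat) : f k%:R = 0 by rewrite -[k%:R]mulr1 fMn f1 mulr0.
  by case: m => k; rewrite ?NegzE ?mulrNz ?fN -pmulrn fn ?oppr0.
have fM' x : `|f x| <= M.
  rewrite -[x](subrK (Num.floor x)%:~R) fD fi addr0; apply: fM.
  have := floor_itv x; rewrite intrD => /andP[h1 h2].
  by rewrite subr_ge0 h1 lerBlDl ltW.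
move=> x; apply/eqP/contraT => fx; have fx0 : 0 < `|f x| by rewrite normr_gt0.
have := fM' ((Num.truncn (M / `|f x|)).+1%:R * x).
rewrite fMn normrM normr_nat -ler_pdivlMr // leNgt => /negP[].
have M0 : 0 <= M by apply: le_trans (fM' x).
by have /andP[] := truncn_itv (divr_ge0 M0 (ltW fx0)).
Qed.

(** The maximum is at [t = x / q]; for [q = 0] the left side is unbounded unless [x = 0]. The
    Cauchy-Schwarz inequalities below come from this. *)
Lemma discriminant_le (R : realFieldType) (x q A : R) : 0 <= q ->
  (forall t, 2 * t * x - t ^+ 2 * q <= A) -> x ^+ 2 <= A * q.
Proof.
move=> q0 H; have [qe|qn] := eqVneq q 0.
  have [->|xn] := eqVneq x 0; first by rewrite expr0n /= qe mulr0.
  have := H ((A + 1) / (2 * x)); rewrite qe mulr0 subr0.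
  have -> : 2 * ((A + 1) / (2 * x)) * x = A + 1 by field.
  lra.
have qp : 0 < q by rewrite lt_def qn.
have := H (x / q); have -> : 2 * (x / q) * x - (x / q) ^+ 2 * q = x ^+ 2 / q by field.
by rewrite ler_pdivrMr.
Qed.

Section JordanVonNeumann.
Variables (R : realType) (V : lmodType R[i]) (Q : V -> R).
Hypothesis Qpar : forall u v, Q (u + v) + Q (u - v) = 2 * Q u + 2 * Q v.
Hypothesis QZ : forall (c : R[i]) u,
  Q (c *: u) = (complex.Re c ^+ 2 + complex.Im c ^+ 2) * Q u.
Hypothesis Q_ge0 : forall u, 0 <= Q u.
Implicit Types (u v w : V).

Let rip u v : R := (Q (u + v) - Q (u - v)) / 4.

Let QN u : Q (- u) = Q u.
Proof. by rewrite -scaleN1r QZ /= oppr0 sqrrN expr1n expr0n addr0 mul1r. Qed.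

Let Q0 : Q 0 = 0.
Proof. by have := QZ 0 0; rewrite scale0r /= expr0n addr0 mul0r. Qed.

Let ripC u v : rip u v = rip v u.
Proof. by rewrite /rip [u + v]addrC -(QN (u - v)) opprB. Qed.

Let rip0 v : rip 0 v = 0.
Proof. by rewrite /rip add0r sub0r QN subrr mul0r. Qed.

Let ripD2 u v w : rip (u + v) w + rip (u - v) w = 2 * rip u w.
Proof.
have h1 := Qpar (u + w) v; have h2 := Qpar (u - w) v.
rewrite /rip [u + v + w]addrAC [u - v + w]addrAC [u + v - w]addrAC [u - v - w]addrAC.
by move: h1 h2; lra.
Qed.

Let ripD w u v : rip (u + v) w = rip u w + rip v w.
Proof.
pose x := 2^-1 *: (u + v); pose y := 2^-1 *: (u - v).
have ex : u = x + y.
  rewrite -scalerDr addrACA addrN addr0 -[u + u]mulr2n -(scaler_nat 2 u).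
  by rewrite scalerA mulVf ?scale1r ?pnatr_eq0.
have ey : v = x - y.
  rewrite -scalerBr opprB [u + v]addrC addrACA addrN addr0 -[v + v]mulr2n.
  by rewrite -(scaler_nat 2 v) scalerA mulVf ?scale1r ?pnatr_eq0.
have := ripD2 x y w; rewrite -ex -ey => ->.
have := ripD2 x x w; rewrite subrr rip0 addr0 => <-; congr (rip _ w).
by rewrite -mulr2n -(scaler_nat 2 x) scalerA divff ?scale1r ?pnatr_eq0.
Qed.

Let rip_bound u v : `|rip u v| <= (Q u + Q v) / 2.
Proof.
have h := Qpar u v; have h1 := Q_ge0 (u + v); have h2 := Q_ge0 (u - v).
by rewrite /rip ler_norml; lra.
Qed.

(** The difference of the two sides is additive in [t], zero at [t = 1] and bounded on [0,1], so
    [additive_bounded_eq0] applies. *)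
Let ripZ (t : R) u v : rip (t%:C%C *: u) v = t * rip u v.
Proof.
apply/eqP; rewrite -subr_eq0; apply/eqP.
apply: (@additive_bounded_eq0 _ (fun t => rip (t%:C%C *: u) v - t * rip u v)
  ((Q u + Q v) / 2 + `|rip u v|)) => [x y||x /andP[x0 x1]].
- by rewrite [(x + y)%:C%C]raddfD /= scalerDl ripD; ring.
- by rewrite [1%:C%C]rmorph1 scale1r mul1r subrr.
apply: le_trans (ler_normB _ _) _; apply: lerD.
  apply: le_trans (rip_bound _ _) _; apply: ler_wpM2r.
    by rewrite invr_ge0.
  by rewrite lerD2r QZ /= expr0n addr0 ler_piMl // expr_le1.
by rewrite normrM ger0_norm // ler_piMl.
Qed.

Let ripii u v : rip ('i%C *: u) ('i%C *: v) = rip u v.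
Proof.
have Qi w : Q ('i%C *: w) = Q w by rewrite QZ /= expr0n expr1n add0r mul1r.
by rewrite /rip -scalerDr -scalerBr !Qi.
Qed.

Let ripNl u v : rip (- u) v = - rip u v.
Proof. by rewrite -scaleN1r -[- 1](rmorphN1 (real_complex R)) ripZ mulN1r. Qed.

Let ripNr u v : rip u (- v) = - rip u v.
Proof. by rewrite ripC ripNl ripC. Qed.

Let ripi u v : rip ('i%C *: u) v = - rip u ('i%C *: v).
Proof. by rewrite -ripii scalerA -expr2 sqr_i scaleN1r ripNl. Qed.

Let ripc (c : R[i]) u v :
  rip (c *: u) v = complex.Re c * rip u v - complex.Im c * rip u ('i%C *: v).
Proof.
have -> : c *: u = (complex.Re c)%:C%C *: u + (complex.Im c)%:C%C *: ('i%C *: u).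
  by rewrite scalerA -scalerDl [_ * 'i%C]mulrC -complexE.
by rewrite ripD !ripZ ripi mulrN.
Qed.

Lemma jordan_von_neumann : (forall u, Q u = 0 -> u = 0) ->
  exists ip : {dot V for (@Num.conj R[i])},
    (forall u, ip u u = (Q u)%:C%C) /\
    (forall u v, complex.Re (ip u v) = (Q (u + v) - Q (u - v)) / 4).
Proof.
(* Conjugate linearity in [v] forces [Im <u, v> = Re <u, i v>]. *)
move=> Q_eq0; pose ip u v : R[i] := Complex (rip u v) (rip u ('i%C *: v)).
have ipl w : GRing.linear_for *%R (ip^~ w).
  move=> c u v; apply: complex_eq.
    by rewrite ReD /= ripD ripc; case: c => a b /=.
  rewrite ImD /= ripD ripc scalerA -expr2 sqr_i scaleN1r ripNr.
  by case: c => a b /=; ring.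
have ipC u v : ip u v = (-1) ^+ false * Num.conj (ip v u).
  rewrite expr0 mul1r; apply: complex_eq; first by rewrite ReJ /= ripC.
  by rewrite ImJ /= -ripi [RHS]ripC.
have ipr u : GRing.linear_for (Num.conj \; *%R) (ip u).
  move=> c v w; rewrite ipC expr0 mul1r ipl rmorphD rmorphM /=.
  by rewrite [in RHS]ipC [ip u w]ipC !expr0 !mul1r.
have ipp u : ip u u = (Q u)%:C%C.
  apply: complex_eq => /=.
    rewrite /rip subrr Q0 subr0 -mulr2n -(scaler_nat 2 u) QZ.
    by rewrite -[2%:R]/(2%:R : R[i]) raddfMn /=; field.
  have : rip u ('i%C *: u) = - rip u ('i%C *: u) by rewrite {1}ripC ripi.
  by lra.
have ip_gt0 u : u != 0 -> 0 < ip u u.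
  move=> u0; rewrite ipp ltcR lt_def Q_ge0 andbT.
  by apply: contra_neq u0; exact: Q_eq0.
pose B := bilinear_isBilinear.Build _ _ _ _ _ _ ip (ipl, ipr).
pose H := @isHermitianSesquilinear.Build _ _ false (@Num.conj R[i]) ip ipC.
pose D := @isDotProduct.Build _ _ ip ip_gt0.
pose d : {dot V for (@Num.conj R[i])} :=
  HB.pack_for {dot V for (@Num.conj R[i])} ip B H D.
by exists d.
Qed.

End JordanVonNeumann.

Import numFieldNormedType.Exports.
Local Open Scope classical_set_scope.
Local Open Scope ring_scope.

(** * The GNS construction *)

Section Combinations.
Variables (R : realType) (G : groupType) (phi : G -> R[i]).
Implicit Types (h k : G -> R[i]) (y z : seq (R[i] * G)) (s g : G) (c : R[i]).

(** A list [y] stands for the vector [sum c pi(s) xi], and a vector [v] for the function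
    [s |-> <v, pi(s) xi>]. Thus [pairing h y] is [<h, y>], and [kernel_fun y] is the function of the
    vector [y]. *)
Definition pairing h y : R[i] := \sum_(p <- y) Num.conj p.1 * h p.2.

Definition kernel_fun y s : R[i] := \sum_(p <- y) p.1 * phi (s^-1 * p.2)%g.

Definition comb_scale c y := [seq (c * p.1, p.2) | p <- y].

Definition comb_shift g y := [seq (p.1, (g * p.2)%g) | p <- y].

Definition comb_norm y : R := complex.Re (pairing (kernel_fun y) y).

Lemma pairing_cat h y z : pairing h (y ++ z) = pairing h y + pairing h z.
Proof. exact: big_cat. Qed.

Lemma pairing_scale h c y : pairing h (comb_scale c y) = Num.conj c * pairing h y.
Proof.
rewrite /pairing big_map mulr_sumr; apply: eq_bigr => p _.
by rewrite rmorphM mulrA.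
Qed.

Lemma pairing_shift h g y :
  pairing h (comb_shift g y) = pairing (fun s => h (g * s)%g) y.
Proof. by rewrite /pairing big_map. Qed.

Lemma pairingD h k y : pairing (h + k) y = pairing h y + pairing k y.
Proof. by rewrite -big_split; apply: eq_bigr => p _; rewrite mulrDr. Qed.

Lemma pairingZ h c y : pairing (c *: h) y = c * pairing h y.
Proof. by rewrite mulr_sumr; apply: eq_bigr => p _; rewrite mulrCA. Qed.

Lemma pairingN h y : pairing (- h) y = - pairing h y.
Proof. by rewrite -scaleN1r pairingZ mulN1r. Qed.

Lemma kernel_cat y z : kernel_fun (y ++ z) = kernel_fun y + kernel_fun z.
Proof. by apply/funext => s; exact: big_cat. Qed.

Lemma kernel_scale c y : kernel_fun (comb_scale c y) = c *: kernel_fun y.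
Proof.
apply/funext => s; rewrite /kernel_fun big_map [RHS]mulr_sumr.
by apply: eq_bigr => p _; rewrite mulrA.
Qed.

Lemma kernel_shift g y s : kernel_fun (comb_shift g y) s = kernel_fun y (g^-1 * s)%g.
Proof.
by rewrite /kernel_fun big_map; apply: eq_bigr => p _; rewrite invgM invgK mulgA.
Qed.

Lemma comb_norm_scale c y : comb_norm (comb_scale c y) =
  (complex.Re c ^+ 2 + complex.Im c ^+ 2) * comb_norm y.
Proof.
rewrite /comb_norm kernel_scale pairingZ pairing_scale mulrA -normCK.
by rewrite sqr_norm_complex Re_realM.
Qed.

Lemma comb_norm_shift g y : comb_norm (comb_shift g y) = comb_norm y.
Proof.
rewrite /comb_norm pairing_shift; congr (complex.Re (pairing _ _)).
by apply/funext => s; rewrite kernel_shift mulKg.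
Qed.

Hypothesis phi_pd : positive_definite phi.

Lemma pairing_kernel_ge0 y : 0 <= pairing (kernel_fun y) y.
Proof.
have := phi_pd (fun i : 'I_(size y) => (nth (0, 1%g) y i).2)
               (fun i : 'I_(size y) => (nth (0, 1%g) y i).1).
congr (0 <= _); rewrite /pairing (big_nth (0, 1%g)) big_mkord.
apply: eq_bigr => i _; rewrite /kernel_fun (big_nth (0, 1%g)) big_mkord mulr_sumr.
by apply: eq_bigr => j _; rewrite mulrA.
Qed.

Lemma comb_norm_ge0 y : 0 <= comb_norm y.
Proof. by have := pairing_kernel_ge0 y; rewrite lecE => /andP[]. Qed.

(** Positivity on 1 and [s] makes [c phi(s) + conj(c) phi(s^-1)] real; take [c = 1] and [c = i]. *)
Lemma phiV s : phi s^-1%g = Num.conj (phi s).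
Proof.
have phi1 : complex.Im (phi 1%g) = 0.
  have := pairing_kernel_ge0 [:: (1, 1%g)].
  rewrite /pairing /kernel_fun !big_seq1 /= conjC1 !mul1r invg1 mul1g.
  by rewrite lecE => /andP[/eqP].
have H c : complex.Im (c * phi s + Num.conj c * phi s^-1%g) = 0.
  have := pairing_kernel_ge0 [:: (1, 1%g); (c, s)].
  rewrite /pairing /kernel_fun !big_cons !big_nil /= !addr0 conjC1 !mul1r.
  rewrite invg1 mulVg !mul1g mulg1 mulrDr mulrA [Num.conj c * c]mulrC -normCK.
  rewrite lecE => /andP[/eqP + _]; rewrite sqr_norm_complex !ImD Im_realM phi1.
  by rewrite /= mulr0 addr0 add0r -!ImD.
have := H 1; have := H 'i%C; rewrite conjC1 !mul1r.
case: (phi s) (phi s^-1%g) => [x1 y1] [x2 y2] /= h1 h2.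
by apply: complex_eq => /=; lra.
Qed.

Lemma pairing_kernelC y z :
  pairing (kernel_fun y) z = Num.conj (pairing (kernel_fun z) y).
Proof.
rewrite /pairing /kernel_fun rmorph_sum /=.
under eq_bigr do rewrite mulr_sumr.
rewrite exchange_big; apply: eq_bigr => p _ /=.
rewrite rmorphM /= conjCK rmorph_sum mulr_sumr; apply: eq_bigr => q _ /=.
by rewrite rmorphM /= -phiV invgM invgK mulrCA.
Qed.

Lemma comb_norm_cat y z : comb_norm (y ++ z) =
  comb_norm y + 2 * complex.Re (pairing (kernel_fun y) z) + comb_norm z.
Proof.
rewrite /comb_norm kernel_cat pairing_cat !pairingD !ReD.
by rewrite [pairing (kernel_fun z) y]pairing_kernelC ReJ; ring.
Qed.

(** In a Hilbert space [2 Re <h, y> - |y|^2 = |h|^2 - |h - y|^2], whose supremum over a dense set of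
    [y] is [|h|^2]. *)
Definition dominated h := exists C : R, forall y,
  2 * complex.Re (pairing h y) - comb_norm y <= C.

Definition sqr_gns_norm h : R :=
  sup [set 2 * complex.Re (pairing h y) - comb_norm y | y in setT].

Lemma sqr_gns_norm_ub h y : dominated h ->
  2 * complex.Re (pairing h y) - comb_norm y <= sqr_gns_norm h.
Proof.
move=> [C hC]; apply: sup_ubound; last by exists y.
by exists C => _ [z _ <-].
Qed.

Lemma sqr_gns_norm_le h (C : R) :
  (forall y, 2 * complex.Re (pairing h y) - comb_norm y <= C) ->
  sqr_gns_norm h <= C.
Proof.
move=> hC; apply: ge_sup; last by move=> _ [z _ <-].
by eexists; exists [::].
Qed.

Lemma sqr_gns_norm_ge0 h : dominated h -> 0 <= sqr_gns_norm h.
Proof.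
move=> /(sqr_gns_norm_ub [::]); rewrite /comb_norm /pairing !big_nil.
by rewrite /= mulr0 subr0.
Qed.

Lemma dominated0 : dominated 0.
Proof.
exists 0 => y; rewrite -(scale0r 0) pairingZ mul0r /= mulr0 sub0r.
by rewrite oppr_le0 comb_norm_ge0.
Qed.

Let scale_bound c h (C : R) : c != 0 ->
  (forall y, 2 * complex.Re (pairing h y) - comb_norm y <= C) ->
  forall y, 2 * complex.Re (pairing (c *: h) y) - comb_norm y <=
    (complex.Re c ^+ 2 + complex.Im c ^+ 2) * C.
Proof.
move=> c0 hC y; pose w := comb_scale c^-1 y.
have ey : y = comb_scale c w.
  rewrite /w /comb_scale -map_comp map_id_in // => -[d s] _ /=.
  by rewrite mulrA divff // mul1r.
rewrite {1}ey pairing_scale pairingZ mulrCA mulrA -normCK sqr_norm_complex Re_realM.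
rewrite ey comb_norm_scale mulrCA -mulrBr ler_wpM2l ?addr_ge0 ?sqr_ge0 //.
Qed.

Lemma dominatedZ c h : dominated h -> dominated (c *: h).
Proof.
move=> [C hC]; have [->|c0] := eqVneq c 0; first by rewrite scale0r; exact: dominated0.
by eexists; exact: scale_bound hC.
Qed.

Lemma sqr_gns_normZ c h : dominated h ->
  sqr_gns_norm (c *: h) = (complex.Re c ^+ 2 + complex.Im c ^+ 2) * sqr_gns_norm h.
Proof.
have le d k : d != 0 -> dominated k ->
    sqr_gns_norm (d *: k) <= (complex.Re d ^+ 2 + complex.Im d ^+ 2) * sqr_gns_norm k.
  move=> d0 dk; apply: sqr_gns_norm_le; apply: scale_bound => // y.
  exact: sqr_gns_norm_ub.
move=> dh; have [->|c0] := eqVneq c 0.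
  rewrite scale0r /= expr0n addr0 mul0r; apply/le_anti.
  rewrite sqr_gns_norm_ge0 ?andbT; last exact: dominated0.
  apply: sqr_gns_norm_le => y.
  by rewrite -(scale0r 0) pairingZ mul0r /= mulr0 sub0r oppr_le0 comb_norm_ge0.
apply/le_anti; rewrite le //= -ler_pdivlMl; last first.
  rewrite lt_def addr_ge0 ?sqr_ge0 // andbT; apply: contra_neq c0 => e.
  by apply/eqP; rewrite -normr_eq0 -sqrf_eq0 sqr_norm_complex e.
have cV0 : c^-1 != 0 by rewrite invr_eq0.
have := le c^-1 (c *: h) cV0 (dominatedZ c dh); rewrite scalerA mulVf // scale1r.
congr (_ <= _ * _); apply: complexI.
by rewrite fmorphV /= -!sqr_norm_complex normfV exprVn.
Qed.

Let half : R[i] := 2^-1.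

Let halfE : half = (2^-1 : R)%:C%C. Proof. by rewrite fmorphV rmorph_nat. Qed.

Let Re_half (w : R[i]) : complex.Re (half * w) = complex.Re w / 2.
Proof. by rewrite halfE Re_realM mulrC. Qed.

(* Substituting [y = p + q], [z = p - q] decouples the two suprema. *)
Let parallelogram_bound h k y z : dominated h -> dominated k ->
  (2 * complex.Re (pairing (h + k) y) - comb_norm y) +
  (2 * complex.Re (pairing (h - k) z) - comb_norm z) <=
  2 * sqr_gns_norm h + 2 * sqr_gns_norm k.
Proof.
move=> dh dk; pose m := comb_scale half.
have hh := sqr_gns_norm_ub (m y ++ m z) dh.
have hk := sqr_gns_norm_ub (m y ++ comb_scale (- half) z) dk.
have chalf : Num.conj half = half by rewrite fmorphV rmorph_nat.
move: hh hk.
rewrite /m !(pairing_cat, comb_norm_cat, pairing_scale, comb_norm_scale, kernel_scale, pairingZ).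
have -> : Num.conj (- half) = - half by rewrite rmorphN; congr (- _).
rewrite chalf !(mulNr, mulrN, ReD, ReN, Re_half, pairingD, pairingN) halfE.
by rewrite [complex.Re _%:C%C]/= [complex.Im _%:C%C]/= ImN /= oppr0; lra.
Qed.

Lemma dominatedD h k : dominated h -> dominated k -> dominated (h + k).
Proof.
move=> dh dk; exists (2 * sqr_gns_norm h + 2 * sqr_gns_norm k) => y.
have := parallelogram_bound y [::] dh dk.
by rewrite /comb_norm /pairing !big_nil /= mulr0 !subr0 addr0.
Qed.

Lemma dominatedN h : dominated h -> dominated (- h).
Proof. by rewrite -scaleN1r; exact: dominatedZ. Qed.

Let parallelogram_le h k : dominated h -> dominated k ->
  sqr_gns_norm (h + k) + sqr_gns_norm (h - k) <=
  2 * sqr_gns_norm h + 2 * sqr_gns_norm k.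
Proof.
move=> dh dk; rewrite -lerBrDr; apply: sqr_gns_norm_le => y.
rewrite lerBrDr addrC -lerBrDr; apply: sqr_gns_norm_le => z.
by rewrite lerBrDr addrC; exact: parallelogram_bound.
Qed.

(** The reverse inequality is [parallelogram_le] applied to [h + k] and [h - k]. *)
Lemma sqr_gns_norm_parallelogram h k : dominated h -> dominated k ->
  sqr_gns_norm (h + k) + sqr_gns_norm (h - k) =
  2 * sqr_gns_norm h + 2 * sqr_gns_norm k.
Proof.
move=> dh dk; apply/le_anti; rewrite parallelogram_le //=.
have := parallelogram_le (dominatedD dh dk) (dominatedD dh (dominatedN dk)).
have -> : (h + k) + (h - k) = (2 : R[i]) *: h.
  by rewrite addrACA subrr addr0 scaler_nat mulr2n.
have -> : (h + k) - (h - k) = (2 : R[i]) *: k.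
  by rewrite opprB [h + k]addrC addrACA subrr addr0 scaler_nat mulr2n.
rewrite !sqr_gns_normZ //.
have -> : (2 : R[i]) = (2 : R)%:C%C by rewrite rmorph_nat.
by rewrite /=; lra.
Qed.

(* Polarized, this is the reproducing property of the kernel [phi (s^-1 * t)]. *)
Lemma sqr_gns_normD_kernel h y : dominated h ->
  dominated (h + kernel_fun y) /\
  sqr_gns_norm (h + kernel_fun y) =
  sqr_gns_norm h + 2 * complex.Re (pairing h y) + comb_norm y.
Proof.
have le k z w : dominated k ->
    2 * complex.Re (pairing (k + kernel_fun z) w) - comb_norm w <=
    sqr_gns_norm k + 2 * complex.Re (pairing k z) + comb_norm z.
  move=> dk; have := sqr_gns_norm_ub (w ++ comb_scale (- 1) z) dk.
  have cN1 : Num.conj (- 1 : R[i]) = - 1 by rewrite rmorphN rmorph1.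
  rewrite pairing_cat comb_norm_cat !pairing_scale comb_norm_scale cN1 !mulN1r.
  rewrite pairingD [pairing (kernel_fun z) w]pairing_kernelC !ReD !ReN ReJ /=.
  by rewrite oppr0; lra.
move=> dh; have dhy : dominated (h + kernel_fun y) by eexists => w; exact: le.
split=> //; apply/le_anti; rewrite sqr_gns_norm_le //=; last by move=> w; exact: le.
have := sqr_gns_norm_le (fun w => le (h + kernel_fun y) (comb_scale (- 1) y) w dhy).
have cN1 : Num.conj (- 1 : R[i]) = - 1 by rewrite rmorphN rmorph1.
rewrite kernel_scale scaleN1r addrK pairing_scale comb_norm_scale cN1 mulN1r ReN.
by rewrite pairingD ReD /= oppr0 -/(comb_norm y); lra.
Qed.

Lemma dominated_kernel y : dominated (kernel_fun y).
Proof. by have [] := sqr_gns_normD_kernel y dominated0; rewrite add0r. Qed.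

Lemma dominated_shift g h : dominated h -> dominated (fun s => h (g^-1 * s)%g).
Proof.
move=> [C hC]; exists C => y; have := hC (comb_shift g^-1%g y).
by rewrite pairing_shift comb_norm_shift.
Qed.

Lemma sqr_gns_norm_shift g h : dominated h ->
  sqr_gns_norm (fun s => h (g^-1 * s)%g) = sqr_gns_norm h.
Proof.
have le g' k : dominated k ->
    sqr_gns_norm (fun s => k (g'^-1 * s)%g) <= sqr_gns_norm k.
  move=> dk; apply: sqr_gns_norm_le => y.
  by rewrite -pairing_shift -(comb_norm_shift g'^-1%g); exact: sqr_gns_norm_ub.
move=> dh; apply/le_anti; rewrite le //=.
have := le g^-1%g _ (dominated_shift g dh).
by under eq_fun do rewrite invgK mulKg.
Qed.

(** The square norm of [h - y] is the gap between the supremum and its value at [y], so a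
    near-maximizer works. *)
Lemma kernel_dense h (e : R) : dominated h -> 0 < e ->
  exists y, sqr_gns_norm (h - kernel_fun y) < e.
Proof.
move=> dh e0; pose E := [set 2 * complex.Re (pairing h y) - comb_norm y | y in setT].
have Es : has_sup E.
  split; first by eexists; exists [::].
  by case: dh => C hC; exists C => _ [z _ <-].
have [_ [y _ <-] hy] := sup_adherent e0 Es; exists y.
have := (sqr_gns_normD_kernel (comb_scale (- 1) y) dh).2.
have cN1 : Num.conj (- 1 : R[i]) = - 1 by rewrite rmorphN rmorph1.
rewrite kernel_scale scaleN1r pairing_scale comb_norm_scale cN1 mulN1r ReN.
by move=> ->; move: hy; rewrite -/(sqr_gns_norm h) /= oppr0; lra.
Qed.

Lemma pairing_dominated h y : dominated h ->
  complex.Re (pairing h y) ^+ 2 <= sqr_gns_norm h * comb_norm y.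
Proof.
move=> dh; apply: discriminant_le (comb_norm_ge0 y) _ => t.
have := sqr_gns_norm_ub (comb_scale t%:C%C y) dh.
rewrite pairing_scale comb_norm_scale.
have -> : Num.conj t%:C%C = t%:C%C :> R[i] by apply: complex_eq; rewrite ?ReJ ?ImJ /= ?oppr0.
by rewrite Re_realM /= expr0n addr0 mulrA.
Qed.

Lemma pairing_dominated_le h y (x : R) : dominated h -> 0 <= x ->
  sqr_gns_norm h <= x ^+ 2 ->
  `|complex.Re (pairing h y)| <= x * Num.sqrt (comb_norm y).
Proof.
move=> dh x0 hx; have q0 := comb_norm_ge0 y.
rewrite -ler_sqr ?nnegrE ?mulr_ge0 ?sqrtr_ge0 // real_normK ?num_real //.
rewrite exprMn sqr_sqrtr //; apply: le_trans (pairing_dominated y dh) _.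
exact: ler_wpM2r.
Qed.

Lemma sqr_gns_normD_le h k (x y : R) : dominated h -> dominated k ->
  0 <= x -> 0 <= y -> sqr_gns_norm h <= x ^+ 2 -> sqr_gns_norm k <= y ^+ 2 ->
  sqr_gns_norm (h + k) <= (x + y) ^+ 2.
Proof.
move=> dh dk x0 y0 hx ky; apply: sqr_gns_norm_le => w; rewrite pairingD ReD.
have := pairing_dominated_le w dh x0 hx; have := pairing_dominated_le w dk y0 ky.
rewrite !ler_norml => /andP[_ h1] /andP[_ h2].
set s := Num.sqrt _ in h1 h2; have -> : comb_norm w = s ^+ 2.
  by rewrite sqr_sqrtr // comb_norm_ge0.
(* What remains is [2 (x + y) s - s^2 <= (x + y)^2]. *)
have := sqr_ge0 (x + y - s); rewrite sqrrB -mulr_natr; move: h1 h2.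
by rewrite -subr_ge0 => h1; rewrite -subr_ge0 => h2 h3; lra.
Qed.

Lemma sqr_gns_norm_eq0 h : dominated h -> sqr_gns_norm h = 0 -> h = 0.
Proof.
move=> dh h0.
have H y : complex.Re (pairing h y) = 0.
  apply/eqP; rewrite -sqrf_eq0; apply/eqP/le_anti; rewrite sqr_ge0 andbT.
  by apply: le_trans (pairing_dominated y dh) _; rewrite h0 mul0r.
apply/funext => s; apply: complex_eq.
  by have := H [:: (1, s)]; rewrite /pairing big_seq1 conjC1 mul1r.
have := H [:: ('i%C, s)]; rewrite /pairing big_seq1.
by case: (h s) => a b /=; lra.
Qed.

End Combinations.

(** Helly's theorem on the line: the supremum of the left endpoints lies in every interval. It
    supplies the pointwise limits for completeness. *)
Lemma overlapping_intervals (R : realType) (T : Type) (t0 : T) (a e : T -> R) :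
  (forall t t', a t - e t <= a t' + e t') ->
  exists x, forall t, `|a t - x| <= e t.
Proof.
move=> ae; pose E := [set a t - e t | t in setT].
exists (sup E) => t; rewrite ler_distlC; apply/andP; split.
  apply: sup_ubound; last by exists t.
  by exists (a t0 + e t0) => _ [t' _ <-].
apply: ge_sup; first by exists (a t - e t); exists t.
by move=> _ [t' _ <-].
Qed.

(** The proof of positivity is an argument so that the subspace instance, which depends on it, can
    be attached to the predicate. *)
Definition gns_pred (R : realType) (G : groupType) (phi : G -> R[i])
    of positive_definite phi : {pred G -> R[i]} :=
  fun h => `[< dominated phi h >].

Record gns_space (R : realType) (G : groupType) (phi : G -> R[i])
    (phi_pd : positive_definite phi) := GnsSpace {
  gns_fun : G -> R[i];
  gns_funP : gns_fun \in gns_pred phi_pd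
}.

(** * The Hilbert space of dominated functions *)

Section GnsSpace.
Variables (R : realType) (G : groupType) (phi : G -> R[i]).
Variable phi_pd : positive_definite phi.

Lemma gns_predP h : h \in gns_pred phi_pd <-> dominated phi h.
Proof. by split => /asboolP. Qed.

Lemma gns_pred_closed : subsemimod_closed (gns_pred phi_pd).
Proof.
split; first split.
- by apply/gns_predP; exact: dominated0.
- by move=> h k /gns_predP dh /gns_predP dk; apply/gns_predP; exact: dominatedD.
- by move=> c h /gns_predP dh; apply/gns_predP; exact: dominatedZ.
Qed.

HB.instance Definition _ :=
  GRing.isSubmodClosed.Build _ _ (gns_pred phi_pd) gns_pred_closed.
HB.instance Definition _ := [isSub for @gns_fun R G phi phi_pd].
HB.instance Definition _ := [Choice of gns_space phi_pd by <:].
HB.instance Definition _ := [SubChoice_isSubLmodule of gns_space phi_pd by <:].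

Notation H := (gns_space phi_pd).
Implicit Types u v : H.

Lemma gns_dominated u : dominated phi (val u).
Proof. by apply/gns_predP; exact: valP. Qed.

Definition gns_sqr u : R := sqr_gns_norm phi (val u).

Lemma gns_sqr_ge0 u : 0 <= gns_sqr u.
Proof. exact: sqr_gns_norm_ge0 (gns_dominated u). Qed.

Lemma gns_sqrZ (c : R[i]) u :
  gns_sqr (c *: u) = (complex.Re c ^+ 2 + complex.Im c ^+ 2) * gns_sqr u.
Proof. by rewrite /gns_sqr linearZ sqr_gns_normZ //; exact: gns_dominated. Qed.

Lemma gns_sqr_parallelogram u v :
  gns_sqr (u + v) + gns_sqr (u - v) = 2 * gns_sqr u + 2 * gns_sqr v.
Proof.
rewrite /gns_sqr raddfD raddfB /=.
by apply: sqr_gns_norm_parallelogram => //; exact: gns_dominated.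
Qed.

Lemma gns_sqr_eq0 u : gns_sqr u = 0 -> u = 0.
Proof.
move=> u0; apply: val_inj; rewrite raddf0.
exact: sqr_gns_norm_eq0 (gns_dominated u) u0.
Qed.

Definition gns_norm u : R[i] := (Num.sqrt (gns_sqr u))%:C%C.

Lemma gns_sqrD_le u v (x y : R) : 0 <= x -> 0 <= y -> gns_sqr u <= x ^+ 2 ->
  gns_sqr v <= y ^+ 2 -> gns_sqr (u + v) <= (x + y) ^+ 2.
Proof.
move=> x0 y0 ux vy; rewrite /gns_sqr raddfD.
by apply: sqr_gns_normD_le => //; exact: gns_dominated.
Qed.

Lemma gns_normD u v : gns_norm (u + v) <= gns_norm u + gns_norm v.
Proof.
rewrite /gns_norm -rmorphD lecR.
rewrite -ler_sqr ?nnegrE ?addr_ge0 ?sqrtr_ge0 // sqr_sqrtr ?gns_sqr_ge0 //.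
by apply: gns_sqrD_le; rewrite ?sqrtr_ge0 // sqr_sqrtr ?gns_sqr_ge0.
Qed.

Lemma gns_normZ (c : R[i]) u : gns_norm (c *: u) = `|c| * gns_norm u.
Proof.
rewrite /gns_norm gns_sqrZ sqrtrM ?addr_ge0 ?sqr_ge0 // rmorphM.
by rewrite normc_def.
Qed.

Lemma gns_norm_eq0 u : gns_norm u = 0 -> u = 0.
Proof.
move=> /complexI /eqP; rewrite sqrtr_eq0 => u0; apply: gns_sqr_eq0.
by apply/le_anti; rewrite u0 gns_sqr_ge0.
Qed.

HB.instance Definition _ :=
  Lmodule_isNormed.Build R[i] H gns_normD gns_normZ gns_norm_eq0.

Lemma gns_ballE u (e : R) v : 0 < e -> ball u e%:C%C v <-> gns_sqr (u - v) < e ^+ 2.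
Proof.
move=> e0; rewrite -ball_normE /ball_ /=.
rewrite -[ `|u - v| ]/(gns_norm (u - v)) ltcR.
by rewrite -ltr_sqr ?nnegrE ?sqrtr_ge0 ?(ltW e0) // sqr_sqrtr ?gns_sqr_ge0.
Qed.

Lemma gns_sqrN u : gns_sqr (- u) = gns_sqr u.
Proof. by rewrite -scaleN1r gns_sqrZ /= oppr0 sqrrN expr1n expr0n addr0 mul1r. Qed.

Section Completeness.
Variable F : set_system H.
Hypotheses (FF : ProperFilter F) (Fc : cauchy F).

(** Balls belonging to the filter, as centre and radius; they play the part of a Cauchy sequence. *)
Let T := {p : H * R | 0 < p.2 /\ F (ball p.1 p.2%:C%C)}.

Let T_small (e : R) : 0 < e -> exists t : T, (sval t).2 = e.
Proof.
move=> e0; have e0' : 0 < e%:C%C by rewrite ltcR.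
have [u Fu] := (cauchyP F).1 Fc e%:C%C e0'.
by exists (exist _ (u, e) (conj e0 Fu)).
Qed.

Let T_dist (t t' : T) :
  gns_sqr ((sval t).1 - (sval t').1) <= ((sval t).2 + (sval t').2) ^+ 2.
Proof.
case: t t' => [[u e] /= [e0 Fu]] [[u' e'] /= [e0' Fu']].
have [v [uv u'v]] := filter_ex (filterI Fu Fu').
have := (gns_ballE u v e0).1 uv; have := (gns_ballE u' v e0').1 u'v => h' h.
have -> : u - u' = (u - v) + (v - u') by rewrite addrA subrK.
by apply: gns_sqrD_le; rewrite ?(ltW e0) ?(ltW e0') // ?(ltW h) // -gns_sqrN opprB ltW.
Qed.

Let T_lim y : exists x : R, forall t : T,
  `|complex.Re (pairing (val (sval t).1) y) - x| <= (sval t).2 * Num.sqrt (comb_norm phi y).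
Proof.
have [t0 _] := T_small ltr01.
apply: (overlapping_intervals t0) => t t'; rewrite lerBlDr -addrA -lerBlDl -mulrDl.
rewrite [(sval t').2 + _]addrC.
have t0' (r : T) : 0 <= (sval r).2 by case: (svalP r) => /ltW.
have := pairing_dominated_le phi_pd y (gns_dominated ((sval t).1 - (sval t').1))
  (addr_ge0 (t0' t) (t0' t')) (T_dist t t').
by rewrite raddfB /= pairingD pairingN ReD ReN; exact: le_trans (ler_norm _).
Qed.

Let k c s := Num.sqrt (comb_norm phi [:: (c, s)]).

Let T_val_lim s : exists z : R[i], forall t : T,
  `|complex.Re (val (sval t).1 s - z)| <= (sval t).2 * k 1 s /\
  `|complex.Im (val (sval t).1 s - z)| <= (sval t).2 * k 'i%C s.
Proof.
have [x xP] := T_lim [:: (1, s)]; have [y yP] := T_lim [:: ('i%C, s)].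
exists (Complex x y) => t; have := xP t; have := yP t.
rewrite /pairing !big_seq1 conjC1 mul1r /=; case: (gns_fun _ s) => a b /=.
by rewrite mul0r mulN1r opprK add0r.
Qed.

Let lim_fun s : R[i] := sval (cid (T_val_lim s)).

Let lim_bound y : exists C : R, 0 <= C /\ forall t : T,
  `|complex.Re (pairing (val (sval t).1 - lim_fun) y)| <= (sval t).2 * C.
Proof.
elim: y => [|[d s] y [C [C0 hC]]].
  by exists 0; split=> // t; rewrite /pairing big_nil normr0 mulr0.
exists (`|complex.Re d| * k 1 s + `|complex.Im d| * k 'i%C s + C); split.
  by rewrite !addr_ge0 ?mulr_ge0 ?sqrtr_ge0.
move=> t; rewrite /pairing big_cons ReD (mulrDr (sval t).2 _ C).
apply: le_trans (ler_normD _ _) _.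
apply: lerD; last exact: hC.
have [] := svalP (cid (T_val_lim s)) t.
have -> : (val (sval t).1 - lim_fun) s = val (sval t).1 s - lim_fun s by [].
rewrite -/(lim_fun s); move: (_ - lim_fun s) => [x y'] /= h1 h2.
case: d => a b /=.
have -> : a * x - - b * y' = a * x + b * y' by ring.
apply: le_trans (ler_normD _ _) _; rewrite !normrM mulrDr.
by apply: lerD; rewrite mulrCA ler_wpM2l.
Qed.

(** Split [u - lim] as [(u - u') + (u' - lim)], with [u'] the centre of a ball of small radius [d'].
    The first part contributes at most [(e + d')^2], the second at most [2 d' C]; although [C]
    depends on [y], the bound [e^2] left as [d'] shrinks does not. *)
Let lim_sqr_bound (t : T) y :
  2 * complex.Re (pairing (val (sval t).1 - lim_fun) y) - comb_norm phi y <=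
  (sval t).2 ^+ 2.
Proof.
have [C [C0 hC]] := lim_bound y; set e := (sval t).2.
have e0 : 0 <= e by case: (svalP t) => /ltW.
apply/ler_addgt0Pr => d d0.
(* As [d' <= 1], the excess over [e^2] is at most [d' (2e + 1 + 2C) <= d]. *)
pose d' := Num.min 1 (d / (2 * e + 1 + 2 * C)).
have D0 : 0 < 2 * e + 1 + 2 * C by lra.
have d'0 : 0 < d' by rewrite lt_min ltr01 divr_gt0.
have d'1 : d' <= 1 by rewrite ge_min lexx.
have d'd : d' * (2 * e + 1 + 2 * C) <= d by rewrite -ler_pdivlMr // ge_min lexx orbT.
have [t' et'] := T_small d'0.
have h1 := hC t'; have h2 := T_dist t t'; rewrite et' -/e in h1 h2.
have h3 := sqr_gns_norm_ub y (gns_dominated ((sval t).1 - (sval t').1)).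
rewrite -/(gns_sqr _) raddfB /= pairingD pairingN ReD ReN in h3.
move: h1; rewrite ler_norml => /andP[_]; rewrite !pairingD !pairingN !ReD !ReN => h1.
have h4 : d' ^+ 2 <= d' by rewrite expr2 ler_piMl // ltW.
have := le_trans h3 h2; rewrite sqrrD -mulr_natl; move: h1 h4 d'd => /=.
by rewrite !mulrDr; lra.
Qed.

Lemma gns_complete : cvg F.
Proof.
have [t0 _] := T_small ltr01.
have dl (t : T) : dominated phi (val (sval t).1 - lim_fun).
  by eexists; exact: lim_sqr_bound.
have ll : lim_fun \in gns_pred phi_pd.
  apply/gns_predP; have -> : lim_fun = val (sval t0).1 - (val (sval t0).1 - lim_fun).
    by rewrite opprB addrC subrK.
  by apply: dominatedD => //; [exact: gns_dominated|exact: dominatedN].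
pose l : H := GnsSpace ll; apply: (@cvgP _ _ l); apply/cvg_ballP => e e0.
have [r r0 er] : exists2 r : R, 0 < r & e = r%:C%C.
  exists (complex.Re e); first by move: e0; rewrite ltcE => /andP[].
  by apply: complex_eq => //=; move: e0; rewrite ltcE => /andP[/eqP].
have r30 : 0 < r / 3 by rewrite divr_gt0.
have [t te] := T_small r30; have [tp Ft] := svalP t.
have lu : gns_sqr (l - (sval t).1) <= (r / 3) ^+ 2.
  rewrite -gns_sqrN opprB -te /gns_sqr raddfB.
  by apply: sqr_gns_norm_le => y; exact: lim_sqr_bound.
apply: filterS Ft => v /(gns_ballE _ _ tp); rewrite te er => uv.
apply/gns_ballE => //.
have -> : l - v = (l - (sval t).1) + ((sval t).1 - v) by rewrite addrA subrK.
have := gns_sqrD_le (ltW r30) (ltW r30) lu (ltW uv).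
by move=> /le_lt_trans; apply; rewrite ltr_sqr ?nnegrE; lra.
Qed.

End Completeness.

HB.instance Definition _ := Uniform_isComplete.Build H gns_complete.

Lemma gns_hilbert : exists ip : {dot H for (@Num.conj R[i])},
  (forall u : H, `|u| ^+ 2 = ip u u) /\
  (forall u v, complex.Re (ip u v) = (gns_sqr (u + v) - gns_sqr (u - v)) / 4).
Proof.
have [ip [ipp ipr]] := jordan_von_neumann gns_sqr_parallelogram gns_sqrZ
  gns_sqr_ge0 gns_sqr_eq0.
exists ip; split=> // u; rewrite ipp -[ `|u| ]/(gns_norm u) /gns_norm -rmorphXn /=.
by rewrite sqr_sqrtr ?gns_sqr_ge0.
Qed.

Lemma gns_kernel_in y : kernel_fun phi y \in gns_pred phi_pd.
Proof. by apply/gns_predP; exact: dominated_kernel. Qed.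

Definition gns_kernel y : H := GnsSpace (gns_kernel_in y).

Lemma gns_shift_in g u : (fun s => val u (g^-1 * s)%g) \in gns_pred phi_pd.
Proof. by apply/gns_predP; apply: dominated_shift; exact: gns_dominated. Qed.

Definition gns_shift g u : H := GnsSpace (gns_shift_in g u).

Lemma gns_shift_linear g : linear (gns_shift g).
Proof. by move=> c u v; apply: val_inj. Qed.

HB.instance Definition _ g :=
  GRing.isLinear.Build R[i] H H _ (gns_shift g) (gns_shift_linear g).

Lemma gns_sqr_shift g u : gns_sqr (gns_shift g u) = gns_sqr u.
Proof. by apply: sqr_gns_norm_shift; exact: gns_dominated. Qed.

Lemma gns_shift1 u : gns_shift 1%g u = u.
Proof. by apply: val_inj; apply/funext => s /=; rewrite invg1 mul1g. Qed.

Lemma gns_shiftM g g' u : gns_shift (g * g')%g u = gns_shift g (gns_shift g' u).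
Proof. by apply: val_inj; apply/funext => s /=; rewrite invgM mulgA. Qed.

End GnsSpace.

(** The real part at [-i u] is the imaginary part at [u]. *)
Lemma homogeneous_eqRe (R : realType) (V : lmodType R[i]) (f g : V -> R[i]) :
  (forall c u, f (c *: u) = c * f u) -> (forall c u, g (c *: u) = c * g u) ->
  (forall u, complex.Re (f u) = complex.Re (g u)) -> f =1 g.
Proof.
move=> fZ gZ e u; apply: complex_eq => //.
have := e (- 'i%C *: u); rewrite fZ gZ.
by case: (f u) (g u) => a b [c d] /=; lra.
Qed.

Theorem gns_exists (R : realType) (G : groupType) (phi : G -> R[i]) : state phi ->
  exists (H : hilbert R) (pi : unitary_rep G H) (xi : H), is_GNS phi pi xi.
Proof.
move=> [phi_pd phi1]; have [ip [ipn ipr]] := gns_hilbert phi_pd.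
pose H := Hilbert ipn.
(* The reproducing property; its real part is polarized from [sqr_gns_normD_kernel]. *)
have ip_kernel u y : ip u (gns_kernel phi_pd y) = pairing (val u) y.
  move: u; apply: homogeneous_eqRe => [c u|c u|u].
  - exact: linearZl_LR.
  - by rewrite linearZ pairingZ.
  rewrite ipr /gns_sqr raddfD raddfB /=.
  have -> : gns_fun u - kernel_fun phi y =
      gns_fun u + kernel_fun phi (comb_scale (- 1) y) by rewrite kernel_scale scaleN1r.
  rewrite !(sqr_gns_normD_kernel phi_pd _ (gns_dominated u)).2.
  rewrite pairing_scale comb_norm_scale rmorphN rmorph1 mulN1r ReN /= oppr0.
  by field.
have unitary g : @unitary_op R H H (gns_shift g).
  split=> [v w|w]; last first.
    by exists (gns_shift g^-1%g w); rewrite -gns_shiftM mulgV gns_shift1.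
  move: v; apply: homogeneous_eqRe => [c u|c u|u] /=.
  - by rewrite linearZ /= linearZl_LR.
  - exact: linearZl_LR.
  by rewrite !ipr -(linearD (gns_shift g)) -(linearB (gns_shift g)) !gns_sqr_shift.
pose pi : unitary_rep G H := UnitaryRep unitary (@gns_shift1 _ _ _ phi_pd)
  (@gns_shiftM _ _ _ phi_pd).
pose xi : H := gns_kernel phi_pd [:: (1, 1%g)].
have pixi s : ip (pi s xi) xi = phi s.
  rewrite /xi ip_kernel /pairing big_seq1 conjC1 mul1r /= /kernel_fun big_seq1.
  by rewrite mul1r /= mulg1 mulg1 invgK.
exists H, pi, xi; split=> //.
  have /eqP : `|xi| ^+ 2 = 1 by rewrite ipn -[X in ip X _](gns_shift1) -phi1 -pixi.
  by rewrite sqrp_eq1 // => /eqP.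
rewrite /cyclic_vector; apply/seteqP; split=> // u _ B /nbhs_ballP[e e0 eB].
have [r r0 er] : exists2 r : R, 0 < r & e = r%:C%C.
  exists (complex.Re e); first by move: e0; rewrite /= ltcE => /andP[].
  by apply: complex_eq => //=; move: e0; rewrite /= ltcE => /andP[/eqP].
(* Kernel functions are exactly the combinations of translates of [xi], so their density is
   cyclicity. *)
have [y hy] := kernel_dense phi_pd (gns_dominated u) (exprn_gt0 2 r0).
exists (gns_kernel phi_pd y); split; last first.
  by apply: eB; rewrite er; apply/gns_ballE.
pose f i := nth (0, 1%g) y i.
exists (size y), (fun i => (f i).2), (fun i => (f i).1).
apply: val_inj; rewrite raddf_sum /=; apply/funext => s.
rewrite fct_sumE /kernel_fun (big_nth (0, 1%g)) big_mkord; apply: eq_bigr => i _.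
by rewrite /= !fctE big_seq1 mul1r mulg1 invgM invgK.
Qed.

(** * Hilbert spaces and unitary representations *)

Section HilbertSpaces.
Variables (R : realType) (H : hilbert R).
Implicit Types u v w : H.

Definition sqr_norm u : R := complex.Re (inner H u u).

Lemma innerC u v : inner H u v = Num.conj (inner H v u).
Proof. by rewrite hermC expr0 mul1r. Qed.

Lemma inner_eq0 u : inner H u u = 0 -> u = 0.
Proof. by move=> e; apply/eqP; rewrite -(dnorm_eq0 (inner H)) e. Qed.

Lemma conj_real (x : R) : Num.conj x%:C%C = x%:C%C :> R[i].
Proof. by apply: complex_eq; rewrite ?ReJ ?ImJ /= ?oppr0. Qed.

Lemma inner_sqr_norm u : inner H u u = (sqr_norm u)%:C%C.
Proof.
apply: complex_eq => //=; have := dnorm_ge0 (inner H) u.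
by rewrite lecE => /andP[/eqP].
Qed.

Lemma sqr_norm_ge0 u : 0 <= sqr_norm u.
Proof. by have := dnorm_ge0 (inner H) u; rewrite lecE => /andP[]. Qed.

Lemma sqr_norm_eq0 u : sqr_norm u = 0 -> u = 0.
Proof. by move=> u0; apply: inner_eq0; rewrite inner_sqr_norm u0. Qed.

Lemma sqr_normN u : sqr_norm (- u) = sqr_norm u.
Proof. by rewrite /sqr_norm linearNl linearNr opprK. Qed.

Lemma sqr_normD u v :
  sqr_norm (u + v) = sqr_norm u + 2 * complex.Re (inner H u v) + sqr_norm v.
Proof.
rewrite /sqr_norm linearDl !linearDr /= !ReD [inner H v u]innerC ReJ; lra.
Qed.

Lemma sqr_normZ (t : R) u : sqr_norm (t%:C%C *: u) = t ^+ 2 * sqr_norm u.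
Proof.
by rewrite /sqr_norm linearZl_LR linearZr_LR /= conj_real !Re_realM expr2 mulrA.
Qed.

Lemma Re_inner_sqr_le u v :
  complex.Re (inner H u v) ^+ 2 <= sqr_norm u * sqr_norm v.
Proof.
apply: discriminant_le (sqr_norm_ge0 v) _ => t.
have := sqr_norm_ge0 (u - t%:C%C *: v).
rewrite sqr_normD sqr_normN sqr_normZ linearNr linearZr_LR /= conj_real ReN Re_realM.
by lra.
Qed.

Lemma ball_sqr_norm u (e : R) v : 0 < e ->
  ball u e%:C%C v <-> sqr_norm (u - v) < e ^+ 2.
Proof.
move=> e0; rewrite -ball_normE /ball_ /=.
have -> : `|u - v| = (complex.Re `|u - v|)%:C%C.
  by rewrite RRe_real // normr_real.
rewrite ltcR -ltr_sqr ?nnegrE ?(ltW e0) //; last first.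
  by have := normr_ge0 (u - v); rewrite lecE => /andP[].
suff -> : complex.Re `|u - v| ^+ 2 = sqr_norm (u - v) by [].
rewrite /sqr_norm -inner_norm.
have : complex.Im `|u - v| = 0 by apply: ger0_Im.
by case: `|u - v| => a b /= ->; rewrite mulr0 subr0.
Qed.

(** By the parallelogram law ([Adist]), the near-minimizers of the distance to [M] generate a Cauchy
    filter; their near-orthogonality ([Aorth]) passes to its limit. *)
Lemma closed_subspace_proj (M : set H) u : closed_subspace M ->
  exists2 m, M m & forall w, M w -> inner H (u - m) w = 0.
Proof.
move=> [Mcl M0 ML].
have MD v w : M v -> M w -> M (v + w) by move=> Mv Mw; rewrite -[v]scale1r; exact: ML.
have MZ (c : R[i]) v : M v -> M (c *: v) by move=> Mv; rewrite -[c *: v]addr0; exact: ML.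
pose E := [set sqr_norm (u - w) | w in M].
have Ei : has_inf E.
  split; first by eexists; exists 0.
  by exists 0 => _ [w _ <-]; exact: sqr_norm_ge0.
pose d := inf E.
have dle w : M w -> d <= sqr_norm (u - w).
  by move=> Mw; apply: inf_lbound; [case: Ei|exists w].
pose A (e : R) := [set w | M w /\ sqr_norm (u - w) < d + e].
have Aex e : 0 < e -> A e !=set0.
  move=> e0; have [_ [w Mw <-] lt] := inf_adherent e0 Ei.
  by exists w.
have Aorth e x w : A e x -> M w ->
    complex.Re (inner H (u - x) w) ^+ 2 <= e * sqr_norm w.
  move=> [Mx xe] Mw; apply: discriminant_le (sqr_norm_ge0 w) _ => t.
  have := dle (x + t%:C%C *: w) (MD _ _ Mx (MZ _ _ Mw)).
  rewrite opprD addrA sqr_normD sqr_normN sqr_normZ linearNr linearZr_LR /=.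
  rewrite conj_real ReN Re_realM; lra.
have Adist e x y : A e x -> A e y -> sqr_norm (x - y) < 4 * e.
  move=> [Mx xe] [My ye].
  have hx : sqr_norm (u - (2^-1 : R)%:C%C *: (x + y)) >= d by apply: dle; apply: MZ; exact: MD.
  have e1 : u - x + (u - y) = (2 : R)%:C%C *: (u - (2^-1 : R)%:C%C *: (x + y)).
    rewrite scalerBr scalerA -rmorphM divff ?pnatr_eq0 // rmorph1 scale1r.
    by rewrite rmorph_nat scaler_nat mulr2n opprD addrACA.
  have -> : x - y = (u - y) - (u - x) by rewrite opprB [u - y]addrC addrACA subrr addr0 addrC.
  have h1 := sqr_normD (u - y) (u - x); rewrite [u - y + _]addrC e1 sqr_normZ in h1.
  have := sqr_normD (u - y) (- (u - x)); rewrite sqr_normN linearNr ReN => ->.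
  lra.
pose F := filter_from [set e : R | 0 < e] A.
have FF : ProperFilter F.
  apply: filter_from_proper => //; apply: filter_from_filter; first by exists 1 => /=; exact: ltr01.
  move=> e e' /= e0 e'0; exists (Num.min e e'); first by rewrite /= lt_min e0.
  move=> w [Mw]; rewrite /A /= => h; split; split=> //; apply: lt_le_trans h _.
    by rewrite lerD2l ge_min lexx.
  by rewrite lerD2l ge_min lexx orbT.
have Fc : cauchy F.
  apply: cauchy_exP => e e0.
  have er : e = (complex.Re e)%:C%C.
    by apply: complex_eq => //=; move: e0; rewrite ltcE => /andP[/eqP].
  have r0 : 0 < complex.Re e by move: e0; rewrite ltcE => /andP[].
  set r := complex.Re e in er r0; have d0 : 0 < r ^+ 2 / 4 by rewrite divr_gt0 ?exprn_gt0.
  have [x Ax] := Aex _ d0; exists x, (r ^+ 2 / 4) => // y Ay.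
  rewrite er; apply/ball_sqr_norm => //; apply: lt_le_trans (Adist _ _ _ Ax Ay) _.
  lra.
have Fm := cauchy_cvg F Fc; set m := lim F in Fm.
have Mm : M m.
  apply: Mcl => B /Fm [e e0 AB]; have [x Ax] := Aex _ e0.
  by exists x; split; [case: Ax|exact: AB].
exists m => // w Mw.
suff H0 v : M v -> complex.Re (inner H (u - m) v) = 0.
  apply: complex_eq; first exact: H0.
  have := H0 _ (MZ 'i%C w Mw); rewrite linearZr_LR /=.
  by case: (inner _ _ _) => a b /=; lra.
move=> Mv; apply/eqP; rewrite -normr_le0; apply/ler_addgt0Pl => e e0.
rewrite addr0.
have W0 := sqr_norm_ge0 v; set W := sqr_norm v in W0.
(* Half of [e] covers the defect of the near-minimizer [x], half the distance from [m] to [x];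
   [W + 1] keeps the denominator positive when [v = 0]. *)
pose dl := e ^+ 2 / (4 * (W + 1)).
have dl0 : 0 < dl by rewrite divr_gt0 ?exprn_gt0 // mulr_gt0 // ltr_wpDl.
have dlW : dl * W <= (e / 2) ^+ 2.
  rewrite /dl mulrAC ler_pdivrMr ?mulr_gt0 ?ltr_wpDl //.
  have := sqr_ge0 e; rewrite (_ : (e / 2) ^+ 2 * (4 * (W + 1)) = e ^+ 2 * W + e ^+ 2); first lra.
  by field.
have FA : F (A dl) by exists dl.
have FB : F (ball m (Num.sqrt dl)%:C%C).
  by apply: Fm; apply: nbhsx_ballx; rewrite ltcR sqrtr_gt0.
have [x [Ax]] := filter_ex (filterI FA FB).
move=> /ball_sqr_norm; rewrite sqrtr_gt0 sqr_sqrtr ?(ltW dl0) // => /(_ dl0) mx.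
have half_bound (y : R) : y ^+ 2 <= dl * W -> `|y| <= e / 2.
  move=> ydl; rewrite -ler_sqr ?nnegrE ?divr_ge0 ?(ltW e0) // real_normK ?num_real //.
  exact: le_trans dlW.
have -> : u - m = (u - x) - (m - x) by rewrite opprB addrA subrK.
rewrite linearBl ReD ReN /= [e]splitr.
apply: le_trans (ler_normB _ _) _; apply: lerD; apply: half_bound.
  exact: Aorth.
apply: le_trans (Re_inner_sqr_le _ _) _.
by rewrite ler_wpM2r // ltW.
Qed.

End HilbertSpaces.

(** * Cyclic vectors and irreducibility *)

Section Representations.
Variables (R : realType) (G : groupType) (H : hilbert R) (pi : unitary_rep G H).
Implicit Types (u v : H) (s t g : G).

Lemma inner_rep g u v : inner H (pi g u) (pi g v) = inner H u v.
Proof. by have [] := rep_unitary pi g. Qed.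

Lemma inner_repl g u v : inner H (pi g u) v = inner H u (pi g^-1%g v).
Proof. by rewrite -[in LHS](rep1 pi v) -(mulgV g) repM inner_rep. Qed.

Lemma inner_repr g u v : inner H u (pi g v) = inner H (pi g^-1%g u) v.
Proof. by rewrite inner_repl invgK. Qed.

(** Orthogonality to [v] in the span gives [|u - v| >= |u|], so a nonzero [u] is not in the
    closure. *)
Lemma cyclic_orthogonal0 (xi u : H) : cyclic_vector pi xi ->
  (forall s, inner H u (pi s xi) = 0) -> u = 0.
Proof.
move=> cyc uo; apply: sqr_norm_eq0; apply/eqP/contraT => u0.
have up : 0 < sqr_norm u by rewrite lt_def u0 sqr_norm_ge0.
have : closure (orbit_span pi xi) u by rewrite cyc.
move=> /(_ (ball u (Num.sqrt (sqr_norm u))%:C%C)) [].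
  by apply: nbhsx_ballx; rewrite ltcR sqrtr_gt0.
move=> _ [[m [s [c ->]]]] /ball_sqr_norm; rewrite sqrtr_gt0 => /(_ up).
rewrite sqr_sqrtr ?(ltW up) // ltNge => /negP[].
rewrite sqr_normD linearNr linear_sumr /= big1 => [|i _]; last first.
  by rewrite linearZr_LR /= uo mulr0.
by rewrite oppr0 mulr0 addr0 lerDl sqr_norm_ge0.
Qed.

Lemma invariant_cyclic (xi : H) (M : set H) : cyclic_vector pi xi ->
  closed_subspace M -> Defs.invariant pi M -> M xi -> M = setT.
Proof.
move=> cyc [Mcl M0 ML] Mi Mxi; apply/seteqP; split=> // u _; apply: Mcl.
have : closure (orbit_span pi xi) u by rewrite cyc.
apply: closure_subset => _ [m [s [c ->]]].
elim/big_ind: _ => // [v w Mv Mw|i _]; first by rewrite -[v]scale1r; exact: ML.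
by rewrite -[_ *: _]addr0; apply: ML => //; exact: Mi.
Qed.

(* The operator [D] below preserves an invariant subspace and its orthogonal
   complement, so it kills the projection of [xi] along with [xi]. *)
Lemma eigenvectors_line_irreducible (xi : H) (I : finType) (k : I -> G) (lam : R[i]) :
  xi != 0 -> cyclic_vector pi xi -> \sum_i pi (k i) xi = lam *: xi ->
  (forall m, \sum_i pi (k i) m = lam *: m -> exists c, m = c *: xi) ->
  irreducible_rep pi.
Proof.
move=> xi0 cyc kxi line; split; first by exists xi.
move=> M Mcl Mi; have [m Mm mo] := closed_subspace_proj xi Mcl.
case: (Mcl) => _ M0 ML.
have MD v w : M v -> M w -> M (v + w) by move=> Mv Mw; rewrite -[v]scale1r; exact: ML.
have MZ (c : R[i]) v : M v -> M (c *: v) by move=> Mv; rewrite -[c *: v]addr0; exact: ML.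
pose D u := \sum_i pi (k i) u - lam *: u.
have DM u : M u -> M (D u).
  move=> Mu; apply: (MD); last by rewrite -scaleNr; exact: MZ.
  by elim/big_ind: _ => [||i _]; [exact: M0|exact: MD|exact: Mi].
have Dorth u : (forall w, M w -> inner H u w = 0) -> forall w, M w -> inner H (D u) w = 0.
  move=> uo w Mw; rewrite linearBl linear_sumlz linearZl_LR /= uo // mulr0 subr0.
  by rewrite big1 // => i _; rewrite inner_repl uo //; exact: Mi.
have DB u v : D (u - v) = D u - D v.
  rewrite /D; under eq_bigr do rewrite linearB.
  rewrite sumrB scalerBr !opprB addrACA [RHS]addrACA; congr (_ + _); exact: addrC.
have Dm : D m = 0.
  apply: inner_eq0; have Dxi : D xi = 0 by rewrite /D kxi subrr.
  have := Dorth _ mo (D m) (DM _ Mm); rewrite DB Dxi sub0r linearNl => /eqP.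
  by rewrite oppr_eq0 => /eqP.
have [c em] := line m (subr0_eq Dm).
(* If [m = 0], the orbit of [xi] is orthogonal to [M]; otherwise [xi] itself lies in [M]. *)
have [c0|c0] := eqVneq c 0; [left|right].
  have m0 : m = 0 by rewrite em c0 scale0r.
  apply/seteqP; split=> [w Mw|_ ->//]; apply: cyclic_orthogonal0 cyc _ => s.
  have := mo _ (Mi s^-1%g w Mw); rewrite m0 subr0 => xiw.
  by rewrite inner_repr innerC xiw conjC0.
apply: invariant_cyclic cyc Mcl Mi _.
by rewrite -[xi](scalerK c0) -em; exact: MZ.
Qed.

End Representations.

(** * The states phi_a *)

Section GroupAlgebraExtension.
Variables (R : realType) (G : groupType).
Implicit Types (f phi : G -> R[i]) (x y : group_algebra R G) (s t : G).

Lemma lin_ext_supp f x (D : {fset G}) : (monalg.msupp x `<=` D)%fset ->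
  lin_ext f x = \sum_(s <- D) monalg.mcoeff s x * f s.
Proof.
move=> xD; rewrite /lin_ext (big_fset_incl _ xD) // => s _ /monalg.mcoeff_outdom ->.
by rewrite mul0r.
Qed.

Lemma lin_extD f : {morph lin_ext f : x y / x + y}.
Proof.
move=> x y; pose D := (monalg.msupp x `|` monalg.msupp y)%fset.
rewrite (@lin_ext_supp f _ D); last exact: monalg.msuppD_le.
rewrite (@lin_ext_supp f x D) ?fsubsetUl // (@lin_ext_supp f y D) ?fsubsetUr //.
by rewrite -big_split; apply: eq_bigr => s _; rewrite monalg.mcoeffD mulrDl.
Qed.

Lemma lin_ext0 f : lin_ext f 0 = 0.
Proof. by rewrite /lin_ext monalg.msupp0 big_seq_fset0. Qed.

Lemma lin_ext_of f (c : R[i]) s : lin_ext f (ga_of c s) = c * f s.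
Proof.
rewrite (@lin_ext_supp f _ [fset s]%fset) ?monalg.msuppU_le //.
by rewrite big_seq_fset1 monalg.mcoeffU eqxx.
Qed.

Lemma lin_ext_sum f I (r : seq I) (P : pred I) (F : I -> group_algebra R G) :
  lin_ext f (\sum_(i <- r | P i) F i) = \sum_(i <- r | P i) lin_ext f (F i).
Proof. exact: (big_morph _ (lin_extD f) (lin_ext0 f)). Qed.

Lemma lin_ext_mul f x y :
  lin_ext f (ga_mul x y) = lin_ext (fun s => lin_ext (fun t => f (s * t)%g) y) x.
Proof.
rewrite /ga_mul lin_ext_sum; apply: eq_bigr => s _.
rewrite lin_ext_sum /lin_ext mulr_sumr; apply: eq_bigr => t _.
by rewrite -/(lin_ext _ _) lin_ext_of mulrA.
Qed.

Lemma lin_ext_star f x : lin_ext f (ga_star x) =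
  Num.conj (lin_ext (fun s => Num.conj (f s^-1%g)) x).
Proof.
rewrite /ga_star lin_ext_sum /lin_ext rmorph_sum; apply: eq_bigr => s _.
by rewrite -/(lin_ext _ _) lin_ext_of rmorphM /= conjCK.
Qed.

End GroupAlgebraExtension.

Section EigenDefect.
Variables (R : realType) (n : nat) (lam : R).
Implicit Types (phi psi : free_group n -> R[i]) (s t : free_group n).

(** For [phi(s) = <pi(s) xi, xi>] this is [<(sum_j u_j - lam) xi, pi(s) xi>], and [total_defect] is
    the square norm of [(sum_j u_j - lam) xi]. *)
Definition eigen_defect phi s : R[i] :=
  \sum_(j < n) phi (s^-1 * gen j)%g - lam%:C%C * phi s^-1%g.

Definition total_defect phi : R[i] :=
  \sum_(i < n) eigen_defect phi (gen i) - lam%:C%C * eigen_defect phi 1%g.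

Lemma lin_ext_gen_sum (f : free_group n -> R[i]) :
  lin_ext f (gen_sum R n - ga_of lam%:C%C 1%g) =
  \sum_(i < n) f (gen i) - lam%:C%C * f 1%g.
Proof.
rewrite lin_extD /gen_sum lin_ext_sum; congr (_ + _).
  by apply: eq_bigr => i _; rewrite lin_ext_of mul1r.
have := lin_extD f (- ga_of lam%:C%C 1%g) (ga_of lam%:C%C 1%g).
by rewrite addNr lin_ext0 lin_ext_of => /esym/eqP; rewrite addr_eq0 => /eqP.
Qed.

Lemma lin_ext_defect phi : let y := gen_sum R n - ga_of lam%:C%C 1%g in
  lin_ext phi (ga_mul (ga_star y) y) = total_defect phi.
Proof.
move=> y; rewrite lin_ext_mul lin_ext_star /y lin_ext_gen_sum rmorphB rmorph_sum /=.
congr (_ - _).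
  apply: eq_bigr => i _; by rewrite conjCK lin_ext_gen_sum mulg1.
by rewrite rmorphM /= conj_real conjCK lin_ext_gen_sum mulg1.
Qed.

Lemma total_defect_convex phi phi1 phi2 (t : R[i]) :
  (forall s, phi s = t * phi1 s + (1 - t) * phi2 s) ->
  total_defect phi = t * total_defect phi1 + (1 - t) * total_defect phi2.
Proof.
move=> e; have dE s : eigen_defect phi s =
    t * eigen_defect phi1 s + (1 - t) * eigen_defect phi2 s.
  rewrite /eigen_defect e (eq_bigr _ (fun j _ => e _)) big_split /= -!mulr_sumr.
  by ring.
rewrite /total_defect dE (eq_bigr _ (fun j _ => dE _)) big_split /= -!mulr_sumr.
by ring.
Qed.

Variables (H : hilbert R) (pi : unitary_rep (free_group n) H) (xi : H).

Definition defect_vector (u : H) : H := \sum_i pi (gen i) u - lam%:C%C *: u.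

Lemma inner_defect_vector s : inner H (defect_vector xi) (pi s xi) =
  eigen_defect (fun s => inner H (pi s xi) xi) s.
Proof.
rewrite linearBl linear_sumlz linearZl_LR /= inner_repr; congr (_ - _).
by apply: eq_bigr => i _; rewrite inner_repr -repM.
Qed.

Lemma sqr_norm_defect_vector : inner H (defect_vector xi) (defect_vector xi) =
  total_defect (fun s => inner H (pi s xi) xi).
Proof.
rewrite {2}/defect_vector linearBr linear_sumr linearZr_LR /= conj_real.
rewrite -[X in _ - _ * inner H _ X](rep1 pi xi) inner_defect_vector; congr (_ - _).
by apply: eq_bigr => i _; rewrite inner_defect_vector.
Qed.

End EigenDefect.

Section RepCombination.
Variables (R : realType) (G : groupType) (H : hilbert R) (pi : unitary_rep G H).
Variable xi : H.

Definition rep_comb (y : seq (R * G)) : H := \sum_(p <- y) p.1%:C%C *: pi p.2 xi.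

Lemma sqr_norm_rep_comb y : sqr_norm (rep_comb y) =
  \sum_(p <- y) \sum_(q <- y) p.1 * q.1 *
    complex.Re (inner H (pi (q.2^-1 * p.2)%g xi) xi).
Proof.
rewrite /sqr_norm {1}/rep_comb linear_sumlz Re_sum; apply: eq_bigr => p _ /=.
rewrite linear_sumr Re_sum; apply: eq_bigr => q _ /=.
rewrite linearZl_LR linearZr_LR /= conj_real !Re_realM mulrA.
by rewrite inner_repr -repM.
Qed.

End RepCombination.

Section DominatedRep.
Variables (R : realType) (n : nat) (a lam C : R).
Hypothesis hn : (2 <= n)%N.
Variables (H : hilbert R) (pi : unitary_rep (free_group n) H) (xi : H).
Hypothesis hdom : forall y : seq (R * free_group n),
  sqr_norm (rep_comb pi xi y) <=
  C * \sum_(p <- y) \sum_(q <- y) p.1 * q.1 * phiR a (p.2^-1 * q.2)%g.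

(** Cauchy-Schwarz and [hdom] dominate the coefficients of [m] with constant [C |m|^2], so
    [dominated_eigenfunction] applies. *)
Let Re_eigenvector (m : H) s : \sum_i pi (gen i) m = lam%:C%C *: m ->
  complex.Re (inner H m (pi s xi)) = complex.Re (inner H m xi) * phiR a s.
Proof.
move=> em; rewrite -[in RHS](rep1 pi xi).
apply: (@dominated_eigenfunction _ _ lam hn a
  (fun s => complex.Re (inner H m (pi s xi))) (sqr_norm m * C)) => [y|t].
  rewrite -mulrA; apply: le_trans (ler_wpM2l (sqr_norm_ge0 _) (hdom y)).
  apply: le_trans (Re_inner_sqr_le _ _); rewrite /rep_comb linear_sumr Re_sum.
  by under [X in _ <= X ^+ 2]eq_bigr do rewrite linearZr_LR /= conj_real Re_realM.
rewrite -Re_realM -linearZl_LR -em linear_sumlz Re_sum.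
by apply: eq_bigr => i _; rewrite /= repM inner_repl.
Qed.

Lemma dominated_eigenvector (m : H) s : \sum_i pi (gen i) m = lam%:C%C *: m ->
  inner H m (pi s xi) = inner H m xi * (phiR a s)%:C%C.
Proof.
move=> em; rewrite mulrC; apply: complex_eq.
  by rewrite Re_realM Re_eigenvector // mulrC.
have em' : \sum_i pi (gen i) (- 'i%C *: m) = lam%:C%C *: (- 'i%C *: m).
  rewrite scalerA mulrC -scalerA -em scaler_sumr.
  by apply: eq_bigr => i _; rewrite linearZ.
have := Re_eigenvector s em'; rewrite !linearZl_LR Im_realM /=.
case: (inner H m (pi s xi)) (inner H m xi) => x y [x' y'] /=.
by rewrite oppr0 !mul0r !sub0r !mulN1r !opprK mulrC.
Qed.

End DominatedRep.

Section Phi.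
Variables (R : realType) (n : nat) (a : R).
Hypotheses (hn : (2 <= n)%N) (ha : 0 <= a <= 1).

Let phi := @phi_a R n a.

(** The kernel is real and symmetric: for [c = x + iy] the imaginary part cancels under exchange of
    indices, and the real part is the sum of the forms at [x] and [y]. *)
Lemma phi_a_positive_definite : positive_definite phi.
Proof.
move=> m s c; pose x i := complex.Re (c i); pose y i := complex.Im (c i).
pose p i j := phiR a ((s i)^-1 * s j)%g.
have pC i j : p i j = p j i by rewrite /p -phiRV invgM invgK.
have E i j : Num.conj (c i) * c j * phi ((s i)^-1 * s j)%g =
    Complex ((x i * x j + y i * y j) * p i j) ((x i * y j - y i * x j) * p i j).
  rewrite /x /y /phi phi_aE -/(p i j); apply: complex_eq.
    by case: (c i) (c j) => ? ? [? ?] /=; rewrite mulr0 subr0 mulNr opprK.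
  by case: (c i) (c j) => ? ? [? ?] /=; rewrite mulr0 add0r mulNr.
rewrite (eq_bigr _ (fun i _ => eq_bigr _ (fun j _ => E i j))) lecE.
rewrite Im_sum Re_sum /=; apply/andP; split.
  under eq_bigr do rewrite Im_sum /=.
  pose S := \sum_(i < m) \sum_(j < m) x i * y j * p i j.
  have -> : \sum_(i < m) \sum_(j < m) (x i * y j - y i * x j) * p i j = S - S.
    rewrite {2}/S [X in _ - X]exchange_big -sumrB; apply: eq_bigr => i _ /=.
    by rewrite -sumrB; apply: eq_bigr => j _; rewrite mulrBl (pC j i) [x j * y i]mulrC.
  by rewrite subrr.
under eq_bigr do rewrite Re_sum /=.
have -> : \sum_(i < m) \sum_(j < m) (x i * x j + y i * y j) * p i j =
    (\sum_(i < m) \sum_(j < m) x i * x j * p i j) +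
    (\sum_(i < m) \sum_(j < m) y i * y j * p i j).
  rewrite -big_split; apply: eq_bigr => i _ /=.
  by rewrite -big_split; apply: eq_bigr => j _; rewrite mulrDl.
by rewrite addr_ge0 // phiR_psd.
Qed.

Lemma phi_a_state : state phi.
Proof. by split; [exact: phi_a_positive_definite|rewrite /phi phi_aE phiR1]. Qed.

(** The vertices [s^-1] and [s^-1 u_j] form one cell, so [phiR_gater] reduces the equation to
    [cell_gram_sum]. *)
Lemma phi_a_defect s : eigen_defect (n%:R * a) phi s = 0.
Proof.
rewrite /eigen_defect /phi (eq_bigr _ (fun j _ => phi_aE _ _)) phi_aE -rmorphM -rmorph_sum.
rewrite -rmorphB /=; set t := s^-1%g.
have E c : phiR a (t * cell c)%g = cell_gram a c (gate t^-1%g) * phiR a (t * cell (gate t^-1%g))%g.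
  exact: phiR_gater.
have -> : phiR a t = cell_gram a None (gate t^-1%g) * phiR a (t * cell (gate t^-1%g))%g.
  by rewrite -E mulg1.
rewrite (eq_bigr _ (fun j _ => E (Some j))) -mulr_suml mulrA.
rewrite (eq_bigr _ (fun j _ => cell_gramC a (Some j) _)) cell_gram_sum //.
by rewrite [cell_gram a None _]cell_gramC !mulrA subrr.
Qed.

Lemma phi_a_eigenstate : eigenstate (gen_sum R n) (n%:R * a)%:C%C phi.
Proof.
split; first exact: phi_a_state.
have := lin_ext_defect (n%:R * a) phi => /= ->.
by rewrite /total_defect phi_a_defect mulr0 subr0 big1 // => i _; exact: phi_a_defect.
Qed.

Section GNS.
Variables (H : hilbert R) (pi : unitary_rep (free_group n) H) (xi : H).
Hypothesis gns : is_GNS phi pi xi.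

Lemma gns_eigenvector : \sum_i pi (gen i) xi = (n%:R * a)%:C%C *: xi.
Proof.
case: gns => _ cyc e; apply: subr0_eq; apply: (cyclic_orthogonal0 cyc) => s.
have := inner_defect_vector (n%:R * a) pi xi s; rewrite /defect_vector => ->.
rewrite -(phi_a_defect s) /eigen_defect e; congr (_ - _).
by apply: eq_bigr => j _; rewrite e.
Qed.

(** Here domination is an equality with [C = 1], and rigidity gives [m] and [<m, xi> xi] the same
    coefficients on the orbit. *)
Lemma gns_eigenline (lam : R) (m : H) :
  \sum_i pi (gen i) m = lam%:C%C *: m -> m = inner H m xi *: xi.
Proof.
case: gns => _ cyc e em; apply: subr0_eq; apply: (cyclic_orthogonal0 cyc) => s.
rewrite linearBl linearZl_LR /= (@dominated_eigenvector _ _ a lam 1 hn _ _ _ _ m s) //.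
  by rewrite [inner H xi _]innerC -e /phi phi_aE conj_real subrr.
move=> y; rewrite mul1r sqr_norm_rep_comb le_eqVlt; apply/orP; left; apply/eqP.
apply: eq_bigr => p _; apply: eq_bigr => q _.
by rewrite -e /phi phi_aE /= -phiRV invgM invgK.
Qed.

Lemma gns_neq0 : xi != 0.
Proof. by case: gns => n1 _ _; rewrite -normr_eq0 n1 oner_eq0. Qed.

Lemma gns_irreducible : irreducible_rep pi.
Proof.
case: (gns) => _ cyc _.
apply: (eigenvectors_line_irreducible gns_neq0 cyc gns_eigenvector) => m em.
by exists (inner H m xi); exact: gns_eigenline em.
Qed.

End GNS.

(** The total defects of [psi1] and [psi2] are nonnegative with weighted sum 0, so the cyclic vector
    of [psi1] is an [na]-eigenvector. Since [t psi1] is dominated by [phi], rigidity applies with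
    [C = t^-1]. *)
Lemma phi_a_extreme (psi1 psi2 : free_group n -> R[i]) (t : R) :
  state psi1 -> state psi2 -> 0 < t < 1 ->
  (forall s, phi s = t%:C%C * psi1 s + (1 - t)%:C%C * psi2 s) -> psi1 =1 phi.
Proof.
move=> st1 st2 /andP[t0 t1] e.
have [H1 [pi1 [xi1 [xi11 cyc1 e1]]]] := gns_exists st1.
have [H2 [pi2 [xi2 [xi21 cyc2 e2]]]] := gns_exists st2.
have sn0 (H : hilbert R) (pi : unitary_rep (free_group n) H) xi psi :
    (forall s, psi s = inner H (pi s xi) xi) ->
    total_defect (n%:R * a) psi =
      (sqr_norm (defect_vector (n%:R * a) pi xi))%:C%C.
  by move=> /funext ->; rewrite -sqr_norm_defect_vector inner_sqr_norm.
have dv : defect_vector (n%:R * a) pi1 xi1 = 0.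
  have phi0 : total_defect (n%:R * a) phi = 0.
    by rewrite /total_defect phi_a_defect mulr0 subr0 big1 // => i _; exact: phi_a_defect.
  have e' s : phi s = t%:C%C * psi1 s + (1 - t%:C%C) * psi2 s.
    by rewrite e rmorphB rmorph1.
  have := total_defect_convex (n%:R * a) e'; rewrite phi0 (sn0 _ _ _ _ e1) (sn0 _ _ _ _ e2).
  have -> : 1 - t%:C%C = (1 - t)%:C%C by rewrite rmorphB rmorph1.
  rewrite -!rmorphM -rmorphD -[0](rmorph0 (real_complex R)) => /complexI.
  have n1 := sqr_norm_ge0 (defect_vector (n%:R * a) pi1 xi1).
  have n2 := sqr_norm_ge0 (defect_vector (n%:R * a) pi2 xi2).
  have m1 := mulr_ge0 (ltW t0) n1.
  have m2 : 0 <= (1 - t) * sqr_norm (defect_vector (n%:R * a) pi2 xi2).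
    by rewrite mulr_ge0 // subr_ge0 ltW.
  move=> z; apply: sqr_norm_eq0; apply/eqP.
  have : t * sqr_norm (defect_vector (n%:R * a) pi1 xi1) == 0 by apply/eqP; lra.
  by rewrite mulf_eq0 gt_eqF.
have hdom y : sqr_norm (rep_comb pi1 xi1 y) <=
    t^-1 * \sum_(p <- y) \sum_(q <- y) p.1 * q.1 * phiR a (p.2^-1 * q.2)%g.
  rewrite mulrC ler_pdivlMr //.
  have -> : \sum_(p <- y) \sum_(q <- y) p.1 * q.1 * phiR a (p.2^-1 * q.2)%g =
      t * sqr_norm (rep_comb pi1 xi1 y) + (1 - t) * sqr_norm (rep_comb pi2 xi2 y).
    rewrite !sqr_norm_rep_comb !mulr_sumr -big_split; apply: eq_bigr => p _ /=.
    rewrite !mulr_sumr -big_split; apply: eq_bigr => q _ /=.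
    have := e (q.2^-1 * p.2)%g; rewrite /phi phi_aE -e1 -e2.
    move=> /(congr1 (@complex.Re R)); rewrite ReD !Re_realM /=.
    by rewrite -phiRV invgM invgK => ->; ring.
  by rewrite mulrC lerDl mulr_ge0 ?sqr_norm_ge0 // subr_ge0 ltW.
move=> s; rewrite e1 innerC (dominated_eigenvector hn hdom s (subr0_eq dv)).
by rewrite -inner_norm xi11 expr1n mul1r conj_real.
Qed.

Lemma phi_a_pure : pure_state phi.
Proof.
split; first exact: phi_a_state.
move=> psi1 psi2 t st1 st2 t01 e; split; first exact: phi_a_extreme e.
apply: (@phi_a_extreme psi2 psi1 (1 - t)) => //; first by case/andP: t01 => ? ?; lra.
by move=> s; rewrite e opprB addrC; congr (_%:C%C * _ + _); ring.
Qed.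

End Phi.

Theorem theorem2p6 (R : realType) (n : nat) (hn : (2 <= n)%N) :
  (forall a : R, 0 <= a <= 1 ->
     [/\ pure_state (@phi_a R n a),
         eigenstate (gen_sum R n) (n%:R * a)%:C%C (@phi_a R n a),
         (exists (H : hilbert R) (pi : unitary_rep (free_group n) H) (xi : H),
            is_GNS (@phi_a R n a) pi xi)
       & forall (H : hilbert R) (pi : unitary_rep (free_group n) H) (xi : H),
           is_GNS (@phi_a R n a) pi xi -> irreducible_rep pi]) /\
  (forall a b : R, 0 <= a <= 1 -> 0 <= b <= 1 -> a <> b ->
     forall (H K : hilbert R) (pi : unitary_rep (free_group n) H)
       (rho : unitary_rep (free_group n) K) (xi : H) (eta : K),
       is_GNS (@phi_a R n a) pi xi -> is_GNS (@phi_a R n b) rho eta ->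
       ~ unitarily_equivalent pi rho).
Proof.
split=> [a ha|a b ha hb ab H K pi rho xi eta gpi grho [U [[Uin _] Upi]]].
  split.
  - exact: phi_a_pure.
  - exact: phi_a_eigenstate.
  - by apply: gns_exists; exact: phi_a_state.
  - by move=> H pi xi; exact: gns_irreducible.
(* An [na]-eigenvector of [rho] must be a multiple of [eta], whose eigenvalue is [nb]; so
   [U xi = 0], against isometry. *)
have eU : \sum_i rho (gen i) (U xi) = (n%:R * a)%:C%C *: U xi.
  rewrite -linearZ -(gns_eigenvector hn gpi) linear_sum.
  by apply: eq_bigr => i _; rewrite Upi.
have [c Uc] : exists c, U xi = c *: eta by eexists; exact: (gns_eigenline hn grho eU).
have Uxi0 : U xi = 0.
  apply/eqP; move/eqP: eU; rewrite Uc; under eq_bigr do rewrite linearZ.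
  rewrite -scaler_sumr (gns_eigenvector hn grho) !scalerA -subr_eq0 -scalerBl.
  rewrite scaler_eq0 [_ * c]mulrC -mulrBr mulf_eq0 -rmorphB -mulrBr.
  rewrite scaler_eq0; case/orP => [/orP[->//|]|->]; last by rewrite orbT.
  move=> /eqP /(congr1 (@complex.Re R)) /= /eqP; rewrite mulf_eq0 pnatr_eq0 subr_eq0.
  by case/orP => /eqP; [lia|move/esym/ab].
have := Uin xi xi; rewrite Uxi0 linear0l => /esym /inner_eq0 /eqP.
by rewrite (negbTE (gns_neq0 gpi)).
Qed.
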